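(* Let $K=-L\Pi^{-1}$ be a rate constant matrix over $V$ with $|V|=n$, and let $t_{\max}>0$. The algorithm StableLazyFastGreedy (implemented with segment trees as described in the context) runs in $$\Theta\big(M_{\mathrm{offdiag}}+M_{\mathrm{diag}}+\mathrm{nnz}(K)\big)+O\Big(\sum_{j=1}^{k+1} j\,c_j\log n\Big)$$ time. If the lazy heuristic works the best, the running time becomes $\Theta(k^3+\mathrm{nnz}(K))+O(k^2\log n)$; if the lazy heuristic works the worst, it becomes $\Theta(k^3n+\mathrm{nnz}(K))+O(k^2n\log n)$.
   Context: Rate constant matrices. $V$ is a finite set with $|V|=n$ (identified with $[n]=\{1,\dots,n\}$). A rate constant matrix over $V$ is $K\in\mathbb{R}^{V\times V}$ with (i) $K_{uv}\ge 0$ for $u\ne v$; (ii) $K_{vv}=-\sum_{u\ne v}K_{uv}$ for all $v$; (iii) there is a positive vector $\pi\in\mathbb{R}^V$ with $K_{uv}\pi_v=K_{vu}\pi_u$ for all $u,v$. Put $\Pi=\mathrm{Diag}(\pi)$ and $L=-K\Pi$, so $K=-L\Pi^{-1}$; $L$ is a graph Laplacian matrix (symmetric, nonpositive off-diagonal entries, zero row sums). $\mathrm{nnz}(K)$ is the number of nonzero entries of $K$; it is assumed that $\mathrm{nnz}(K)=\Omega(n)$. Each arithmetic operation, square root and comparison costs unit time. For a matrix $C$, an index $u$ and a set $J$ of column indices, $C_{uJ}$ is the row vector $(C_{ul})_{l\in J}$. LazyFastGreedy. Initialize $j\leftarrow1$, $S^{(0)}=\varnothing$, $T^{(0)}=V$,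 $d^{(0)}=\mathrm{diag}(L)$, and $b_v\leftarrow0$, $\rho_v\leftarrow d^{(0)}_v/\pi_v$ for $v\in V$. Repeat the following while-iteration: (a) let $u$ maximize $\rho_v$ over $v\in T^{(j-1)}$ (ties broken by a fixed total order; the $\rho_v$ are kept in a binary heap); (b) for $l=b_u+1,\dots,j-1$ compute $C_{ul}=(L_{us^{(l)}}-\langle C_{uJ},C_{s^{(l)}J}\rangle)/C_{s^{(l)}l}$ with $J=[l-1]$; (c) compute $d^{(j-1)}_u=d^{(b_u)}_u-\sum_{l=b_u+1}^{j-1}C_{ul}^2$; (d) set $b_u\leftarrow j-1$, $\rho_u\leftarrow d_u^{(j-1)}/\pi_u$; (e) if $\rho_u\ge\rho_v$ for all $v\in T^{(j-1)}$, set $s^{(j)}=u$; if moreover $\rho_u<1/t_{\max}$, set $k=j-1$ and terminate; otherwise set $S^{(j)}=S^{(j-1)}\cup\{u\}$, $T^{(j)}=T^{(j-1)}\setminus\{u\}$, $C_{uj}=\sqrt{d_u^{(j-1)}}$, and $j\leftarrow j+1$. StableLazyFastGreedy. This is LazyFastGreedy with step (c) replaced by the following procedure StablyComputeDiagonal$(j,u)$. Put $T'=T^{(j-1)}\setminus\{u\}$ and $L^{[j,u]}_{\star v}=\sum_{w\in T'}L_{wv}$ for $v\in S^{(j-1)}\cup\{u\}$. For $l=1,\dots,j-1$ compute $C^{[j,u]}_{\star l}=\big(L^{[j,u]}_{\star s^{(l)}}-\langle C^{[j,u]}_{\star J},C_{s^{(l)}J}\rangle\big)/C_{s^{(l)}l}$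 with $J=[l-1]$; then return $d_u^{(j-1)}=\langle C^{[j,u]}_{\star J},C_{uJ}\rangle-L^{[j,u]}_{\star u}$ with $J=[j-1]$. Segment trees. For each $v\in V$ a segment tree $\mathcal T_v$ over a semigroup (same-sign reals under addition) stores the nonzero off-diagonal entries of the $v$th column of $L$; initialization takes time linear in the number of stored entries, and the query for the sum over a range of consecutive positions and the update of one entry take $O(\log n)$ time each. Whenever $b_u$ is updated in step (d) from $b_u^{\mathrm{old}}$ to $j-1$, the entries of $\mathcal T_u$ at $s^{(l)}$, $l=b_u^{\mathrm{old}}+1,\dots,j-1$, are set to $0$; whenever an element $s$ is removed from $T^{(j-1)}$, the entry at $s$ of $\mathcal T_v$ is set to $0$ for all $v\in S^{(j-1)}$. Each value $L^{[j,u]}_{\star v}$ is obtained by two sum queries on $\mathcal T_v$ (positions before $u$ and positions after $u$). Counters. $b_v$ denotes the value at termination. $c_j$ ($j\in[k+1]$) is the number of while-iterations performed with index $j$. $M_{\mathrm{offdiag}}=\frac12\sum_{v\in V}b_v(b_v-1)$ is the total dimension of the vectors whose inner products are computed in step (b). $M_{\mathrm{diag}}$ is the total dimension of the vectors whose inner products are computed in the calls of StablyComputeDiagonal, i.e. $M_{\mathrm{diag}}=\frac12\sum_{j=1}^{k+1}j(j-1)c_j$. ''The lazy heuristic works the best'' means that $c_j=1$ for all $j\in[k+1]$ (so $b_v=0$ for $v\in T^{(k)}\setminus\{s^{(k+1)}\}$); ''works the worst'' means that $c_1=1$, $c_j=n-j+1$ for $2\le j\le k+1$, and $b_v=k$ for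 all $v\in T^{(k)}$. In all cases $b_{s^{(j)}}=j-1$ for $j\in[k+1]$. *)

(* Defs.v *)
From mathcomp Require Import all_boot all_order all_algebra.
From mathcomp Require Import reals exp.

Set Implicit Arguments.
Unset Strict Implicit.
Unset Printing Implicit Defensive.

Import Order.TTheory GRing.Theory Num.Theory.

Local Open Scope ring_scope.

(* A computation is its result together with its running time.  Unit time is
   charged for each real arithmetic operation, each square root, each comparison
   (of reals or of positions) and each entry written into a segment tree;
   everything else (memory access, control flow) is free. *)
Definition cost (A : Type) : Type := (A * nat)%type.

Definition ret (A : Type) (x : A) : cost A := (x, 0%N).
Definition tick (A : Type) (x : A) : cost A := (x, 1%N).
Definition bind (A B : Type) (m : cost A) (f : A -> cost B) : cost B :=
  let: (x, t) := m in let: (y, t') := f x in (y, (t + t')%N).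

Notation "'let*' x ':=' m 'in' e" := (bind m (fun x => e))
  (at level 200, x name, m at level 200, e at level 200, right associativity).

Fixpoint traverse (A B : Type) (f : A -> cost B) (s : seq A) : cost (seq B) :=
  match s with
  | [::] => ret [::]
  | x :: s' => let* y := f x in let* ys := traverse f s' in ret (y :: ys)
  end.

Section RealRAM.
Variable R : realType.

Definition addT (x y : R) : cost R := tick (x + y).
Definition subT (x y : R) : cost R := tick (x - y).
Definition mulT (x y : R) : cost R := tick (x * y).
Definition divT (x y : R) : cost R := tick (x / y).
Definition sqrtT (x : R) : cost R := tick (Num.sqrt x).
Definition ltT (x y : R) : cost bool := tick (x < y).
Definition geT (x y : R) : cost bool := tick (y <= x).
Definition eqT (x y : R) : cost bool := tick (x == y).
Definition leqT (p q : nat) : cost bool := tick (p <= q)%N.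
Definition ltnT (p q : nat) : cost bool := tick (p < q)%N.
Definition eqnT (p q : nat) : cost bool := tick (p == q).

(* Extra entries of the longer vector are ignored. *)
Fixpoint dotT (x y : seq R) : cost R :=
  match x, y with
  | a :: x', b :: y' =>
      let* p := mulT a b in let* q := dotT x' y' in addT p q
  | _, _ => ret 0
  end.

(* A leaf holds one stored entry with its position; an inner node holds the
   least and the greatest position below it and the sum of the entries below
   it.  [SegEmpty] is only used for a tree without entries. *)
Inductive segtree : Type :=
  | SegEmpty
  | SegLeaf (p : nat) (x : R)
  | SegNode (lo hi : nat) (sum : R) (l r : segtree).

Definition seg_sum (t : segtree) : R :=
  match t with
  | SegEmpty => 0 | SegLeaf _ x => x | SegNode _ _ s _ _ => s
  end.

Definition seg_lo (t : segtree) : nat :=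
  match t with
  | SegEmpty => 0%N | SegLeaf p _ => p | SegNode lo _ _ _ _ => lo
  end.

Definition seg_hi (t : segtree) : nat :=
  match t with
  | SegEmpty => 0%N | SegLeaf p _ => p | SegNode _ hi _ _ _ => hi
  end.

(* [fuel] only serves the recursion: [size e] always suffices. *)
Fixpoint seg_build_rec (fuel : nat) (e : seq (nat * R)) : cost segtree :=
  match fuel, e with
  | _, [::] => ret SegEmpty
  | _, [:: (p, x)] => tick (SegLeaf p x)
  | 0, _ => ret SegEmpty
  | fuel'.+1, _ =>
      let m := (size e)./2 in
      let* l := seg_build_rec fuel' (take m e) in
      let* r := seg_build_rec fuel' (drop m e) in
      let* s := addT (seg_sum l) (seg_sum r) in
      ret (SegNode (seg_lo l) (seg_hi r) s l r)
  end.

(* The entries must be listed by increasing position. *)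
Definition seg_build (e : seq (nat * R)) : cost segtree :=
  seg_build_rec (size e) e.

(* The sum of the entries at the positions p with a <= p < b. *)
Fixpoint seg_query (t : segtree) (a b : nat) : cost R :=
  match t with
  | SegEmpty => ret 0
  | SegLeaf p x =>
      let* i1 := leqT a p in
      let* i2 := ltnT p b in
      ret (if i1 && i2 then x else 0)
  | SegNode lo hi s l r =>
      let* o1 := ltnT hi a in
      let* o2 := leqT b lo in
      if o1 || o2 then ret 0 else
      let* i1 := leqT a lo in
      let* i2 := ltnT hi b in
      if i1 && i2 then ret s else
      let* x := seg_query l a b in
      let* y := seg_query r a b in
      addT x y
  end.

(* Positions that hold no stored entry are left alone. *)
Fixpoint seg_update (t : segtree) (p : nat) (y : R) : cost segtree :=
  match t with
  | SegEmpty => ret t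
  | SegLeaf q x => let* c := eqnT p q in ret (if c then SegLeaf q y else t)
  | SegNode lo hi _ l r =>
      let* c := leqT p (seg_hi l) in
      if c then
        let* l' := seg_update l p y in
        let* s := addT (seg_sum l') (seg_sum r) in
        ret (SegNode lo hi s l' r)
      else
        let* r' := seg_update r p y in
        let* s := addT (seg_sum l) (seg_sum r') in
        ret (SegNode lo hi s l r')
  end.

Section Heap.
Variables (V : Type) (tie : rel V).

(* A max-heap of vertices v with their keys rho_v, as a heap-ordered binary
   tree. *)
Inductive heap : Type :=
  | HNil
  | HNode (v : V) (x : R) (l r : heap).

(* [tie v w] means that v is preferred to w when their keys are equal. *)
Definition preferT (v : V) (x : R) (w : V) (y : R) : cost bool :=
  let* gt := ltT y x in
  if gt then ret true else
  let* e := eqT x y in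
  if e then tick (tie v w) else ret false.

(* Whether the root of [l] is preferred to the root of [r]. *)
Definition left_firstT (l r : heap) : cost bool :=
  match l, r with
  | HNil, _ => ret false
  | HNode _ _ _ _, HNil => ret true
  | HNode v x _ _, HNode w y _ _ => preferT v x w y
  end.

(* Replaces the root of [h] by (v, x) and sifts it down. *)
Fixpoint heap_sift (h : heap) (v : V) (x : R) : cost heap :=
  match h with
  | HNil => ret HNil
  | HNode _ _ l r =>
      let* c := left_firstT l r in
      if c then
        match l with
        | HNil => ret (HNode v x l r)
        | HNode w y _ _ =>
            let* up := preferT w y v x in
            if up then let* l' := heap_sift l v x in ret (HNode w y l' r)
            else ret (HNode v x l r)
        end
      else
        match r with
        | HNil => ret (HNode v x l r)
        | HNode w y _ _ =>
            let* up := preferT w y v x in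
            if up then let* r' := heap_sift r v x in ret (HNode w y l r')
            else ret (HNode v x l r)
        end
  end.

(* Removes the root; the preferred children move up, so the height does not
   grow. *)
Fixpoint heap_pop (h : heap) : cost heap :=
  match h with
  | HNil => ret HNil
  | HNode _ _ l r =>
      let* c := left_firstT l r in
      if c then
        match l with
        | HNil => ret r
        | HNode w y _ _ => let* l' := heap_pop l in ret (HNode w y l' r)
        end
      else
        match r with
        | HNil => ret l
        | HNode w y _ _ => let* r' := heap_pop r in ret (HNode w y l r')
        end
  end.

(* Bottom-up construction of a balanced heap; [fuel] as in [seg_build_rec]. *)
Fixpoint heap_build_rec (fuel : nat) (e : seq (V * R)) : cost heap :=
  match fuel, e with
  | _, [::] | 0, _ => ret HNil
  | fuel'.+1, (v, x) :: e' =>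
      let m := (size e')./2 in
      let* l := heap_build_rec fuel' (take m e') in
      let* r := heap_build_rec fuel' (drop m e') in
      heap_sift (HNode v x l r) v x
  end.

Definition heap_build (e : seq (V * R)) : cost heap :=
  heap_build_rec (size e) e.

Definition ge_rootT (x : R) (h : heap) : cost bool :=
  match h with
  | HNil => ret true
  | HNode _ y _ _ => geT x y
  end.

End Heap.

End RealRAM.

Arguments SegEmpty {R}.
Arguments HNil {R V}.

Section RateConstantMatrix.
Variable R : realType.

Definition detailed_balance n (K : 'M[R]_n) (pi : 'rV[R]_n) : Prop :=
  (forall v, 0 < pi 0 v) /\
  (forall u v, K u v * pi 0 v = K v u * pi 0 u).

Definition rate_constant_matrix n (K : 'M[R]_n) : Prop :=
  [/\ forall u v, u != v -> 0 <= K u v,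
      forall v, K v v = - \sum_(u | u != v) K u v
    & exists pi : 'rV[R]_n, detailed_balance K pi].

Definition laplacian n (K : 'M[R]_n) (pi : 'rV[R]_n) : 'M[R]_n :=
  - (K *m diag_mx pi).

Definition nnz n (K : 'M[R]_n) : nat :=
  #|[set p : 'I_n * 'I_n | K p.1 p.2 != 0]|.

End RateConstantMatrix.

(* [tie] is the total order that breaks ties. *)
Record instance (R : realType) := Instance {
  nvert : nat;
  K_of : 'M[R]_nvert;
  pi_of : 'rV[R]_nvert;
  tmax : R;
  tie : rel 'I_nvert
}.

(* [nnz K = Omega(n)] is assumed with the constant [a]. *)
Definition admissible (R : realType) (a : R) (I : instance R) : Prop :=
  [/\ (0 < nvert I)%N,
      rate_constant_matrix (K_of I) /\ detailed_balance (K_of I) (pi_of I),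
      0 < tmax I,
      [/\ reflexive (@tie _ I), antisymmetric (@tie _ I),
          transitive (@tie _ I) & total (@tie _ I)]
    & a * (nvert I)%:R <= (nnz (K_of I))%:R].

Section StableLazyFastGreedy.
Variables (R : realType) (I : instance R).
Local Notation V := 'I_(nvert I).
Local Notation L := (laplacian (K_of I) (pi_of I)).
Local Notation pi v := (pi_of I 0 v).

(* The lists are numbered from 0: with j = size sel + 1,
     [sel]      = s^(1), ..., s^(j-1), so that T^(j-1) is its complement;
     [Crow v]   = C_v1, ..., C_vl, where l = b_v, or l = j' if v = s^(j');
     [keys]     = the binary heap of the rho_v, v in T^(j-1);
     [trees v]  = the segment tree of v;
     [jlog]     = the values of j in the while-iterations performed so far;
     [halted]   = Some s^(k+1) after termination, None before. *)
Record state := State {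
  sel : seq V;
  Crow : V -> seq R;
  b : V -> nat;
  keys : heap R V;
  trees : V -> segtree R;
  jlog : seq nat;
  halted : option V
}.

Definition column (v : V) : seq (nat * R) :=
  [seq (val w, L w v) | w <- enum V & (w != v) && (L w v != 0)].

Definition initialize : cost state :=
  let* ts := traverse (fun v => seg_build (column v)) (enum V) in
  let* ks := traverse (fun v => let* r := divT (L v v) (pi v) in ret (v, r))
                      (enum V) in
  let* h := heap_build (@tie _ I) ks in
  ret (State [::] (fun=> [::]) (fun=> 0%N) h
             (fun v => nth SegEmpty ts v) [::] None).

(* Continues the row c = (c_1, ..., c_(l-1)) by
     c_l = (x - <c_J, C_sJ>) / C_sl  with J = [l-1],
   for the successive pairs (s, x) = (s^(l), x_l) of [todo]. *)
Fixpoint solve (C : V -> seq R) (c : seq R) (todo : seq (V * R)) :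
    cost (seq R) :=
  match todo with
  | [::] => ret c
  | (s, x) :: todo' =>
      let m := size c in
      let* ip := dotT c (take m (C s)) in
      let* y := subT x ip in
      let* cl := divT y (nth 0 (C s) m) in
      solve C (rcons c cl) todo'
  end.

(* L^[j,u]_{*v}, the sum of L_wv over w in T^(j-1) \ {u}. *)
Definition star_entry (ts : V -> segtree R) (u v : V) : cost R :=
  let* x := seg_query (ts v) 0 u in
  let* y := seg_query (ts v) u.+1 (nvert I) in
  addT x y.

Definition stably_compute_diagonal (ts : V -> segtree R) (C : V -> seq R)
    (S : seq V) (u : V) : cost R :=
  let* Lstar := traverse (star_entry ts u) S in
  let* Lu := star_entry ts u u in
  let* Cstar := solve C [::] (zip S Lstar) in
  let* ip := dotT Cstar (C u) in
  subT ip Lu.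

(* Sets the entries of one tree at the positions in [ps] to 0. *)
Fixpoint clear_entries (t : segtree R) (ps : seq V) : cost (segtree R) :=
  match ps with
  | [::] => ret t
  | p :: ps' => let* t' := seg_update t p 0 in clear_entries t' ps'
  end.

(* Sets the entry at [p] of the trees of the vertices in [vs] to 0. *)
Fixpoint clear_in_trees (ts : V -> segtree R) (p : V) (vs : seq V) :
    cost (V -> segtree R) :=
  match vs with
  | [::] => ret ts
  | v :: vs' =>
      let* t := seg_update (ts v) p 0 in
      clear_in_trees [eta ts with v |-> t] p vs'
  end.

(* One while-iteration.  The tree of u is brought up to date before it is
   queried, since L^[j,u]_{*u} is a sum over T^(j-1) \ {u}.  As u is the root
   of the heap, rho_u is at least every other key iff it is at least the keys
   of the children. *)
Definition iteration (st : state) : cost state :=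
  let: State Sj C bs h ts lg _ := st in
  match h with
  | HNil => ret st
  | HNode u _ hl hr =>
      let j := (size Sj).+1 in
      let todo := drop (bs u) Sj in
      let* Cu := solve C (C u) [seq (s, L u s) | s <- todo] in
      let C' := [eta C with u |-> Cu] in
      let bs' := [eta bs with u |-> j.-1] in
      let* tu := clear_entries (ts u) todo in
      let ts' := [eta ts with u |-> tu] in
      let* d := stably_compute_diagonal ts' C' Sj u in
      let* rho := divT d (pi u) in
      let lg' := rcons lg j in
      let* gel := ge_rootT rho hl in
      let* ger := ge_rootT rho hr in
      if gel && ger then
        let* threshold := divT 1 (tmax I) in
        let* stop := ltT rho threshold in
        if stop then
          ret (State Sj C' bs' (HNode u rho hl hr) ts' lg' (Some u))
        else
          let* Cuj := sqrtT d in
          let* h' := heap_pop (@tie _ I) h in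
          let* ts'' := clear_in_trees ts' u Sj in
          ret (State (rcons Sj u) [eta C' with u |-> rcons Cu Cuj] bs'
                     h' ts'' lg' None)
      else
        let* h' := heap_sift (@tie _ I) h u rho in
        ret (State Sj C' bs' h' ts' lg' None)
  end.

Fixpoint iterate (fuel : nat) (st : state) : cost state :=
  match fuel, halted st with
  | fuel'.+1, None => let* st' := iteration st in iterate fuel' st'
  | _, _ => ret st
  end.

(* The algorithm terminates in the state [st] after [t] units of time. *)
Definition terminates_in (st : state) (t : nat) : Prop :=
  (exists fuel, (let* st0 := initialize in iterate fuel st0) = (st, t)) /\
  halted st <> None.

End StableLazyFastGreedy.

Arguments b {R I}.

Section Counters.
Variables (R : realType) (I : instance R) (st : state I).

Definition k_of : nat := size (sel st).
Definition iter_count (j : nat) : nat := count_mem j (jlog st).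

Definition M_offdiag : R :=
  2^-1 * \sum_v (b st v)%:R * ((b st v)%:R - 1).

Definition M_diag : R :=
  2^-1 * \sum_(1 <= j < k_of.+2) j%:R * (j%:R - 1) * (iter_count j)%:R.

Definition lazy_best : Prop :=
  forall j, (1 <= j <= k_of.+1)%N -> iter_count j = 1%N.

(* The last condition is about v in T^(k). *)
Definition lazy_worst : Prop :=
  [/\ iter_count 1 = 1%N,
      forall j, (2 <= j <= k_of.+1)%N -> iter_count j = (nvert I - j + 1)%N
    & forall v, v \notin sel st -> b st v = k_of].

End Counters.

(* The running time is Theta(A) + O(B) on the executions with property P: it is
   a sum f + g, with constants that depend on nothing but the class P. *)
Definition time_Theta_plus_O (R : realType)
    (P : forall I : instance R, state I -> Prop)
    (A B : forall I : instance R, state I -> R) : Prop :=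
  exists c1 c2 c3 : R, [/\ 0 < c1, 0 < c2, 0 < c3 &
    forall (I : instance R) (st : state I) (t : nat),
      P I st -> terminates_in st t ->
      exists f g : R, [/\ t%:R = f + g,
        c1 * A I st <= f <= c2 * A I st & 0 <= g <= c3 * B I st]].

(* Main.v *)
Require Import Defs.
From mathcomp Require Import all_boot all_order all_algebra.
From mathcomp Require Import reals exp.
From mathcomp Require Import zify lra.

Import Order.TTheory GRing.Theory Num.Theory.
Local Open Scope ring_scope.

(** The computation model counts every arithmetic operation, so the theorem
    amounts to two-sided bounds on an explicit cost, with constants that do not
    depend on the instance.

    Cost of an iteration. In an iteration with index [j], the computation of the
    diagonal entry forms inner products of dimensions 0, ..., j - 2 and one of
    dimension j - 1. Their total dimension is j (j - 1) / 2, and an inner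
    product costs twice its dimension, so the iteration costs at least
    j (j - 1). The row update of the visited vertex [u] forms inner products of
    dimensions b_u, ..., j - 2, hence costs at most as much again. What is left
    is O(j) operations on segment trees and O(1) operations on the heap. Both
    structures keep a height of at most ceil (log2 (n + 1)): updates, siftings
    and removals never increase it, and the range queries are unbounded on one
    side, so that each follows a single path. This is [cost_iteration].

    Initialization costs Theta (nnz K): the trees are built in linear time, and
    so is the heap, while n = O(nnz K) ([initialize_ok]). Adding up gives
      nnz K + 2 M_diag <= time
                       <= 2 nnz K + 19 n + 4 M_diag + O(sum j c_j log n),
    see [run_time]. The term M_offdiag is harmless, because M_offdiag <= M_diag:
    in each iteration the increase of b_u (b_u - 1) is at most j (j - 1).
    When the heuristic works the best or the worst, the counters c_j are known,
    and M_diag is a polynomial in k and n that is computed exactly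
    ([lazy_best_bounds], [lazy_worst_bounds]).

    Termination. Call a vertex fresh if its key was computed since the last
    selection. A fresh vertex that returns to the root of the heap has its key
    reproduced, so it beats its children and is selected; hence at most n
    iterations pass between selections ([iteration_progress]). When one vertex
    is left, all entries that enter its Schur complement have been set to 0 in
    the trees, the computed diagonal entry is 0, and the threshold test succeeds
    ([residual_last]).

    The precise invariants are needed also for the cost: the lengths of the rows
    determine the dimensions of the inner products, and the order of the
    positions in a segment tree determines the path of a query. *)

Set Implicit Arguments.
Unset Strict Implicit.
Unset Printing Implicit Defensive.

(** * Computations with a cost *)

(* [bind] is only to be unfolded by the rewriting rules below: simplification
   would turn a sequence of steps into nested matches on pairs. *)
Arguments bind : simpl never.

Lemma bindE (A B : Type) (m : cost A) (f : A -> cost B) :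
  bind m f = ((f m.1).1, (m.2 + (f m.1).2)%N).
Proof. by case: m => x t; rewrite /bind; case: (f x). Qed.

Lemma val_bind (A B : Type) (m : cost A) (f : A -> cost B) :
  (bind m f).1 = (f m.1).1.
Proof. by rewrite bindE. Qed.

Lemma cost_bind (A B : Type) (m : cost A) (f : A -> cost B) :
  (bind m f).2 = (m.2 + (f m.1).2)%N.
Proof. by rewrite bindE. Qed.

Lemma val_traverse (A B : Type) (f : A -> cost B) (s : seq A) :
  (traverse f s).1 = [seq (f x).1 | x <- s].
Proof. by elim: s => //= x s IHs; rewrite !val_bind /= IHs. Qed.

Lemma cost_traverse (A B : Type) (f : A -> cost B) (s : seq A) :
  (traverse f s).2 = (\sum_(x <- s) (f x).2)%N.
Proof.
elim: s => [|x s IHs] /=; first by rewrite big_nil.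
by rewrite !cost_bind /= IHs big_cons addn0.
Qed.

Lemma cost_traverse_le (A : eqType) (B : Type) (f : A -> cost B) (s : seq A)
    (c : nat) :
  (forall x, x \in s -> (f x).2 <= c)%N -> ((traverse f s).2 <= size s * c)%N.
Proof.
move=> fc; rewrite cost_traverse big_seq.
apply: (@leq_trans (\sum_(x <- s | x \in s) c)%N); first exact: leq_sum.
by rewrite -big_seq big_const_seq count_predT iter_addn_0 mulnC.
Qed.

Lemma eq_in_traverse (A : eqType) (B : Type) (f g : A -> cost B) (s : seq A) :
  {in s, f =1 g} -> traverse f s = traverse g s.
Proof.
elim: s => //= x s IHs fg; rewrite fg ?mem_head // IHs // => y ys.
by apply: fg; rewrite inE ys orbT.
Qed.

(** * Inner products and forward substitution *)

Section Solve.
Variable R : realType.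

Lemma cost_dotT (x y : seq R) :
  (dotT x y).2 = (2 * minn (size x) (size y))%N.
Proof.
elim: x y => [|a x IHx] [|c y] //; rewrite ?min0n ?minn0 //=.
  by rewrite !cost_bind IHx minnSS /=; lia.
Qed.

Lemma dotT0 (x y : seq R) : all (eq_op^~ 0) x -> (dotT x y).1 = 0.
Proof.
elim: x y => [|a x IHx] [|c y] //= /andP[/eqP-> x0].
by rewrite !val_bind /= IHx // mul0r addr0.
Qed.

Variables (I : instance R) (C : 'I_(nvert I) -> seq R).

Lemma size_solve (c : seq R) (todo : seq ('I_(nvert I) * R)) :
  size (solve C c todo).1 = (size c + size todo)%N.
Proof.
elim: todo c => [|[s x] todo IH] c /=; first by rewrite addn0.
by rewrite !val_bind /= IH size_rcons addSnnS.
Qed.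

(** The inner products have the dimensions |c|, |c| + 1, ..., each costs twice
    its dimension, and a subtraction and a division follow each of them. *)
Lemma cost_solve (c : seq R) (todo : seq ('I_(nvert I) * R))
    (x0 : 'I_(nvert I)) :
  (forall i, i < size todo ->
     size c + i <= size (C (nth x0 (unzip1 todo) i)))%N ->
  (solve C c todo).2 = (size todo * (2 * size c + size todo + 1))%N.
Proof.
elim: todo c => [|[s x] todo IH] c //= rows.
rewrite !cost_bind /= cost_dotT.
have le_c : (size c <= size (C s))%N by have := rows 0%N isT; rewrite addn0.
rewrite size_takel // minnn {}IH => [|i lt_i].
  by rewrite size_rcons; lia.
by rewrite size_rcons addSnnS; apply: (rows i.+1).
Qed.

Lemma solve0 (c : seq R) (todo : seq ('I_(nvert I) * R)) :
  all (eq_op^~ 0) c -> all (eq_op^~ 0) (unzip2 todo) ->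
  all (eq_op^~ 0) (solve C c todo).1.
Proof.
elim: todo c => [|[s x] todo IH] c //= c0 /andP[/eqP-> t0].
rewrite !val_bind /= dotT0 // IH // all_rcons c0 subr0 mul0r.
by rewrite eqxx.
Qed.

End Solve.

Lemma eq_in_solve (R : realType) (I : instance R)
    (C D : 'I_(nvert I) -> seq R) (c : seq R) (todo : seq ('I_(nvert I) * R)) :
  {in unzip1 todo, C =1 D} -> solve C c todo = solve D c todo.
Proof.
elim: todo c => [|[s x] todo IH] c //= CD.
rewrite CD ?mem_head // !bindE /= IH // => y y_todo.
by apply: CD; rewrite inE y_todo orbT.
Qed.

(** * Segment trees *)

Section SegmentTrees.
Variable R : realType.
Implicit Types t l r : segtree R.

Fixpoint seg_entries t : seq (nat * R) :=
  match t with
  | SegEmpty => [::]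
  | SegLeaf p x => [:: (p, x)]
  | SegNode _ _ _ l r => seg_entries l ++ seg_entries r
  end.

Fixpoint seg_height t : nat :=
  match t with
  | SegNode _ _ _ l r => (maxn (seg_height l) (seg_height r)).+1
  | _ => 0
  end.

(** The empty tree has both of its bounds at 0; being strict, the separation of
    the children excludes an empty right child. *)
Fixpoint seg_ok t : bool :=
  match t with
  | SegNode lo hi s l r =>
      [&& seg_ok l, seg_ok r, lo == seg_lo l, hi == seg_hi r,
          (seg_hi l < seg_lo r)%N & s == seg_sum l + seg_sum r]
  | _ => true
  end.

Lemma seg_ok_node lo hi s l r : seg_ok (SegNode lo hi s l r) ->
  [/\ seg_ok l, seg_ok r, (seg_hi l < seg_lo r)%N, lo = seg_lo l
    & hi = seg_hi r /\ s = seg_sum l + seg_sum r].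
Proof. by case/and5P=> ? ? /eqP-> /eqP-> /andP[? /eqP->]. Qed.

Lemma seg_lo_hi t : seg_ok t -> (seg_lo t <= seg_hi t)%N.
Proof.
elim: t => // lo hi s l IHl r IHr /seg_ok_node[okl okr lr -> [-> _]] /=.
by apply: leq_trans (IHr okr); apply: leq_trans (IHl okl) (ltnW lr).
Qed.

Lemma seg_entries_bounds t (e : nat * R) : seg_ok t -> e \in seg_entries t ->
  (seg_lo t <= e.1 <= seg_hi t)%N.
Proof.
elim: t => [|p x _|lo hi s l IHl r IHr] //=.
  by rewrite inE => /eqP->; rewrite !leqnn.
case/seg_ok_node=> okl okr lr -> [-> _].
have := seg_lo_hi okl; have := seg_lo_hi okr; rewrite mem_cat.
by move=> ? ? /orP[/(IHl okl)|/(IHr okr)] ?; lia.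
Qed.

(** [seg_ok] relates a stored sum to the two sums below it, as an update does; a
    query relies on its being the sum over all entries. *)
Lemma seg_sumE t : seg_ok t -> seg_sum t = \sum_(e <- seg_entries t) e.2.
Proof.
elim: t => [_|p x _|lo hi s l IHl r IHr] /=; rewrite ?big_nil ?big_seq1 //.
by case/seg_ok_node=> okl okr _ _ [_ ->]; rewrite big_cat /= IHl // IHr.
Qed.

(** The halves have sizes m./2 and m - m./2, so the larger one satisfies the
    recurrence of [up_log 2]. *)
Lemma seg_build_rec_ok (fuel : nat) (e : seq (nat * R)) :
  (size e <= fuel)%N -> sorted ltn (unzip1 e) ->
  let m := seg_build_rec fuel e in
  [/\ seg_entries m.1 = e, seg_ok m.1,
      (seg_height m.1 <= up_log 2 (size e))%N,
      (size e <= m.2 <= (2 * size e).-1)%N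
    & e != [::] ->
      seg_lo m.1 = (head (0%N, 0) e).1 /\ seg_hi m.1 = (last (0%N, 0) e).1].
Proof.
elim: fuel e => [|fuel IH] [|[p x] [|q e']] //.
set e := [:: (p, x), q & e']; set h := (size e)./2 => le_f sorted_e.
have sze : size e = (size e').+2 by [].
have lt_h : (h < size e)%N by rewrite /h sze; lia.
have h_gt0 : (0 < h)%N by rewrite /h sze; lia.
have szt : size (take h e) = h by rewrite size_takel // ltnW.
have szd : size (drop h e) = (size e - h)%N by rewrite size_drop.
have -> : seg_build_rec fuel.+1 e =
    let* l := seg_build_rec fuel (take h e) in
    let* r := seg_build_rec fuel (drop h e) in
    let* s := addT (seg_sum l) (seg_sum r) in
    ret (SegNode (seg_lo l) (seg_hi r) s l r) by [].
have hE : h = (size e)./2 by [].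
clearbody h e; move: (size e') sze => m sze {p x q e'}.
have := IH (drop h e); have := IH (take h e).
case: (seg_build_rec _ (take h e)) => l cl.
case: (seg_build_rec _ (drop h e)) => r cr.
rewrite !bindE szt szd /=.
case; [by lia|by rewrite /unzip1 map_take; apply: take_sorted|].
move=> ent ok_l ht ct [|lo_t hi_t]; first by rewrite -size_eq0 szt; lia.
case; [by lia|by rewrite /unzip1 map_drop; apply: drop_sorted|].
move=> end_ ok_r hd cd [|lo_d hi_d]; first by rewrite -size_eq0 szd; lia.
pose x0 : nat * R := (0%N, 0).
have lt_mid : ((last x0 (take h e)).1 < (head x0 (drop h e)).1)%N.
  rewrite -nth_last szt -nth0 nth_drop addn0 nth_take ?ltn_predL //.
  rewrite -!(nth_map x0 0%N fst) //; last by apply: leq_ltn_trans lt_h; lia.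
  apply: (sorted_ltn_nth ltn_trans); rewrite ?inE ?size_map ?ltn_predL //.
  by apply: leq_ltn_trans lt_h; lia.
split=> //.
- by rewrite ent end_ cat_take_drop.
- by rewrite ok_l ok_r !eqxx hi_t lo_d lt_mid.
- rewrite sze up_log2S // ltnS geq_max.
  apply/andP; split; [apply: leq_trans ht _|apply: leq_trans hd _].
    by apply: leq_up_log; rewrite hE sze /=; lia.
  by apply: leq_up_log; rewrite hE sze /=; lia.
- by lia.
- move=> _; split; first by rewrite lo_t; case: (h) h_gt0 (e) => // ? _ [].
  rewrite hi_d -[in RHS](cat_take_drop h e) last_cat.
  by case: (drop h e) szd => //; rewrite /= => ?; lia.
Qed.

Lemma seg_query0 t (a b : nat) : seg_ok t ->
  (forall e : nat * R, e \in seg_entries t -> (a <= e.1 < b)%N -> e.2 = 0) ->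
  (seg_query t a b).1 = 0.
Proof.
elim: t => [|p x|lo hi s l IHl r IHr] // ok t0.
  rewrite /=; case: ifP => // ab.
  by apply: (t0 (p, x)); rewrite ?mem_head.
rewrite /= ?val_bind /=; case: ifP => // _; rewrite ?val_bind /=.
case: ifP => [/andP[a_lo hi_b]|_].
  have -> : s = seg_sum (SegNode lo hi s l r) by [].
  rewrite seg_sumE // big_seq big1 // => e e_t; apply: t0 => //.
  have /andP[lo_e e_hi] := seg_entries_bounds ok e_t.
  by rewrite (leq_trans a_lo lo_e) (leq_ltn_trans e_hi hi_b).
have [okl okr _ _ _] := seg_ok_node ok.
rewrite ?val_bind /= IHl // ?IHr ?addr0 // => e e_t; apply: t0.
  by rewrite mem_cat e_t orbT.
by rewrite mem_cat e_t.
Qed.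

(** A query range that is unbounded on one side cuts a single path of the tree:
    at each inner node, one of the children lies inside or outside the range
    as a whole. *)
Lemma cost_seg_query t (a b : nat) : seg_ok t ->
  (a <= seg_lo t)%N || (seg_hi t < b)%N ->
  ((seg_query t a b).2 <= 9 * seg_height t + 4)%N.
Proof.
have outside (u : segtree R) : (seg_hi u < a)%N || (b <= seg_lo u)%N ||
    (a <= seg_lo u)%N && (seg_hi u < b)%N -> ((seg_query u a b).2 <= 4)%N.
  case: u => [|p x|lo hi s l r] //=; rewrite ?cost_bind /=.
  by case: ifP => //= _ inside; rewrite ?cost_bind /= inside.
elim: t => [|p x|lo hi s l IHl r IHr] //.
case/seg_ok_node=> okl okr lr -> [-> _] ab.
rewrite /= !cost_bind /=; case: ifP => out; first by rewrite /=; lia.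
rewrite !cost_bind /=; case: ifP => part; first by rewrite /=; lia.
rewrite !cost_bind /=.
have lol := seg_lo_hi okl; have lor := seg_lo_hi okr.
have {}ab : (a <= seg_lo l)%N || (seg_hi r < b)%N by [].
have [cut_l|cut_r] : ((seg_query l a b).2 <= 4)%N \/
    ((seg_query r a b).2 <= 4)%N.
- have [al|al] := leqP a (seg_lo l).
    have [lb|lb] := ltnP (seg_hi l) b; first by left; apply: outside; lia.
    by right; apply: outside; lia.
  have [ar|ar] := leqP a (seg_lo r); first by right; apply: outside; lia.
  by left; apply: outside; lia.
- have := IHr okr ltac:(lia); lia.
have := IHl okl ltac:(lia); lia.
Qed.

Lemma seg_update_ok t (p : nat) (y : R) : seg_ok t ->
  let m := seg_update t p y in
  [/\ seg_ok m.1, seg_lo m.1 = seg_lo t, seg_hi m.1 = seg_hi t,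
      seg_height m.1 = seg_height t
    & (m.2 <= 2 * seg_height t + 1)%N /\
      seg_entries m.1 =
        [seq (e.1, if e.1 == p then y else e.2) | e <- seg_entries t]].
Proof.
elim: t => [|q x|lo hi s l IHl r IHr] //=.
  by rewrite ?bindE /= eq_sym; case: eqP.
move=> ok; have [okl okr lr -> [-> _]] := seg_ok_node ok.
have lol := seg_lo_hi okl; have lor := seg_lo_hi okr.
rewrite bindE /=; case: ifP => p_l; rewrite ?bindE /=.
  have [-> -> -> -> [? ->]] := IHl okl.
  rewrite okr !eqxx lr; split=> //; split; first by lia.
  rewrite map_cat; congr (_ ++ _); rewrite -[LHS]map_id; apply/eq_in_map.
  case=> q x /(seg_entries_bounds okr)/= q_r; case: eqP => // eq_qp.
  by lia.
have [-> -> -> -> [? ->]] := IHr okr.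
rewrite okl !eqxx lr; split=> //; split; first by lia.
rewrite map_cat; congr (_ ++ _); rewrite -[LHS]map_id; apply/eq_in_map.
case=> q x /(seg_entries_bounds okl)/= q_l; case: eqP => // eq_qp.
by lia.
Qed.

(** A position without a stored entry counts as zero. *)
Definition seg_zero_at t (p : nat) : Prop :=
  forall x, (p, x) \in seg_entries t -> x = 0.

Lemma seg_update0_zero t (p q : nat) : seg_ok t ->
  q = p \/ seg_zero_at t q -> seg_zero_at (seg_update t p 0).1 q.
Proof.
move=> ok zq x; have [_ _ _ _ [_ ->]] := seg_update_ok p 0 ok.
case/mapP=> -[q' x'] /= q_t [eq_q ->]; case: eqP => // ne_qp.
by rewrite eq_q in zq; case: zq => [/ne_qp[]|/(_ _ q_t)].
Qed.

End SegmentTrees.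

(** * Heaps *)

Section Heaps.
Variables (R : realType) (V : eqType) (tie : rel V).
Implicit Types (h l r : heap R V) (v w : V) (x y z : R).

Fixpoint heap_entries h : seq (V * R) :=
  match h with
  | HNil => [::]
  | HNode v x l r => (v, x) :: heap_entries l ++ heap_entries r
  end.

Fixpoint heap_height h : nat :=
  match h with
  | HNil => 0
  | HNode _ _ l r => (maxn (heap_height l) (heap_height r)).+1
  end.

Local Notation root_le x h := (ge_rootT x h).1.

Fixpoint heap_ordered h : bool :=
  match h with
  | HNil => true
  | HNode _ x l r =>
      [&& root_le x l, root_le x r, heap_ordered l & heap_ordered r]
  end.

Lemma root_le_trans x y h : x <= y -> root_le x h -> root_le y h.
Proof. by case: h => //= w z _ _ xy /le_trans; apply. Qed.

Lemma preferTP v x w y :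
  if (preferT tie v x w y).1 then y <= x else x <= y.
Proof.
rewrite /preferT !val_bind /=; case: (ltP y x) => [/ltW//|] le_xy.
rewrite val_bind /=; case: eqP => [->|_] /=; last by [].
by case: ifP.
Qed.

Lemma cost_preferT v x w y : ((preferT tie v x w y).2 <= 3)%N.
Proof.
rewrite /preferT !cost_bind /=; case: ifP => //.
by rewrite cost_bind /=; case: ifP.
Qed.

Lemma left_firstTP l r :
  if (left_firstT tie l r).1
  then exists v x l1 l2, l = HNode v x l1 l2 /\ root_le x r
  else l = HNil /\ r = HNil \/
       exists v x r1 r2, r = HNode v x r1 r2 /\ root_le x l.
Proof.
case: l r => [|v x l1 l2] [|w y r1 r2] //=.
- by left.
- by right; exists w, y, r1, r2.
- by exists v, x, l1, l2.
have := preferTP v x w y; case: ifP => _ le_xy; first by exists v, x, l1, l2.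
by right; exists w, y, r1, r2.
Qed.

Lemma cost_left_firstT l r : ((left_firstT tie l r).2 <= 3)%N.
Proof. by case: l r => [|v x l1 l2] [|w y r1 r2] //=; apply: cost_preferT. Qed.

Lemma root_le_heap_sift h v x z :
  x <= z -> root_le z h -> heap_ordered h -> root_le z (heap_sift tie h v x).1.
Proof.
case: h => [|w0 x0 l r] //= xz z0 /and4P[ol or _ _].
rewrite val_bind; case: (left_firstT _ _ _).1.
  case: l ol => [|w y l1 l2] //= le_y.
  rewrite val_bind; case: (preferT _ _ _ _ _).1; rewrite ?val_bind //=.
  exact: le_trans z0.
case: r or => [|w y r1 r2] //= le_y.
rewrite val_bind; case: (preferT _ _ _ _ _).1; rewrite ?val_bind //=.
exact: le_trans z0.
Qed.

(** The old root key does not matter: sifting repairs a heap whose root alone is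
    out of place. *)
Lemma heap_sift_ordered h v x :
  (if h is HNode _ _ l r then heap_ordered l && heap_ordered r else true) ->
  heap_ordered (heap_sift tie h v x).1.
Proof.
elim: h v x => [|w0 x0 l IHl r IHr] v x //= /andP[ol or].
have below k : heap_ordered k ->
    if k is HNode _ _ l r then heap_ordered l && heap_ordered r else true.
  by case: k => //= ? ? ? ? /and4P[_ _ -> ->].
rewrite val_bind; have := left_firstTP l r; case: (left_firstT _ _ _).1.
  case=> [w [y [l1 [l2 [El le_r]]]]]; rewrite {}El in ol IHl *.
  rewrite val_bind; have := preferTP w y v x.
  case: (preferT _ _ _ _ _).1 => le_xy.
    have := IHl v x (below _ ol).
    have := @root_le_heap_sift (HNode w y l1 l2) v _ _ le_xy (lexx y) ol.
    rewrite val_bind; case: (heap_sift _ _ _ _) => l' c /= le_l' ol'.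
    exact/and4P.
  by rewrite /=; apply/and4P; split=> //; apply: root_le_trans le_r.
case=> [[-> ->] //|[w [y [r1 [r2 [Er le_l]]]]]]; rewrite {}Er in or IHr *.
rewrite val_bind; have := preferTP w y v x.
case: (preferT _ _ _ _ _).1 => le_xy.
  have := IHr v x (below _ or).
  have := @root_le_heap_sift (HNode w y r1 r2) v _ _ le_xy (lexx y) or.
  rewrite val_bind; case: (heap_sift _ _ _ _) => r' c /= le_r' or'.
  exact/and4P.
by rewrite /=; apply/and4P; split=> //; apply: root_le_trans le_l.
Qed.

Lemma perm_heap_sift h v x : h <> HNil ->
  perm_eq (heap_entries (heap_sift tie h v x).1)
          ((v, x) :: behead (heap_entries h)).
Proof.
elim: h => [|w0 x0 l IHl r IHr] // _; rewrite [heap_sift _ _ _ _]/= val_bind.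
apply/permP => a; case: (left_firstT _ _ _).1.
  case: l IHl => [|w y l1 l2] IHl //.
  rewrite val_bind; case: (preferT _ _ _ _ _).1 => //.
  have := IHl ltac:(by []); rewrite val_bind; case: (heap_sift _ _ _ _) => h' c.
  move=> /permP perm_h'; have := perm_h' a.
  by rewrite /= !count_cat /= ?count_cat; lia.
case: r IHr => [|w y r1 r2] IHr //.
rewrite val_bind; case: (preferT _ _ _ _ _).1 => //.
have := IHr ltac:(by []); rewrite val_bind; case: (heap_sift _ _ _ _) => h' c.
  move=> /permP perm_h'; have := perm_h' a.
  by rewrite /= !count_cat /= ?count_cat; lia.
Qed.

Lemma heap_height_sift h v x :
  heap_height (heap_sift tie h v x).1 = heap_height h.
Proof.
elim: h => [|w0 x0 l IHl r IHr] //=.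
rewrite val_bind; case: (left_firstT _ _ _).1.
  case: l IHl => [|w y l1 l2] IHl //.
  rewrite val_bind; case: (preferT _ _ _ _ _).1 => //.
  by rewrite val_bind -IHl.
case: r IHr => [|w y r1 r2] IHr //.
rewrite val_bind; case: (preferT _ _ _ _ _).1 => //.
by rewrite val_bind -IHr.
Qed.

Lemma cost_heap_sift h v x :
  ((heap_sift tie h v x).2 <= 6 * heap_height h)%N.
Proof.
elim: h => [|w0 x0 l IHl r IHr] //.
rewrite [heap_sift _ _ _ _]/= cost_bind; have := cost_left_firstT l r.
case: (left_firstT _ _ _).1.
  case: l IHl => [|w y l1 l2] IHl; first by rewrite /=; lia.
  rewrite cost_bind; have := cost_preferT w y v x.
  case: (preferT _ _ _ _ _).1; last by rewrite /=; lia.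
  by rewrite cost_bind; move: IHl; case: (heap_sift _ _ _ _) => h' c /=; lia.
case: r IHr => [|w y r1 r2] IHr; first by rewrite /=; lia.
rewrite cost_bind; have := cost_preferT w y v x.
case: (preferT _ _ _ _ _).1; last by rewrite /=; lia.
by rewrite cost_bind; move: IHr; case: (heap_sift _ _ _ _) => h' c /=; lia.
Qed.

Lemma heap_pop_ordered h :
  heap_ordered h ->
  heap_ordered (heap_pop tie h).1 /\
  forall z, root_le z h -> root_le z (heap_pop tie h).1.
Proof.
elim: h => [|w0 x0 l IHl r IHr] //.
rewrite [heap_ordered _]/= => /and4P[le_l le_r ol or].
rewrite [heap_pop _ _]/= val_bind.
have := left_firstTP l r; case: (left_firstT _ _ _).1.
  case=> [w [y [l1 [l2 [El le_yr]]]]]; rewrite {}El in ol le_l IHl *.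
  move: IHl => /(_ ol)[ol' le_l']; rewrite val_bind.
  move: (le_l' y (lexx y)) ol'; case: (heap_pop _ _) => l' c /= le_yl' ol'.
  by split=> [|z]; [apply/and4P|apply: le_trans].
case=> [[-> ->] //|[w [y [r1 [r2 [Er le_yl]]]]]]; rewrite {}Er in or le_r IHr *.
move: IHr => /(_ or)[or' le_r']; rewrite val_bind.
move: (le_r' y (lexx y)) or'; case: (heap_pop _ _) => r' c /= le_yr' or'.
by split=> [|z]; [apply/and4P|apply: le_trans].
Qed.

Lemma perm_heap_pop h :
  perm_eq (heap_entries (heap_pop tie h).1) (behead (heap_entries h)).
Proof.
apply/permP => a; elim: h => [|w0 x0 l IHl r IHr] //.
rewrite [heap_pop _ _]/= val_bind; case: (left_firstT _ _ _).1.
  case: l IHl => [|w y l1 l2] // IHl.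
  rewrite val_bind; move: IHl.
  by rewrite /= !count_cat /= ?count_cat => ->; lia.
case: r IHr => [|w y r1 r2] IHr; first by rewrite /= cats0.
by rewrite val_bind; move: IHr; rewrite /= !count_cat /= ?count_cat => ->; lia.
Qed.

Lemma heap_height_pop h : (heap_height (heap_pop tie h).1 <= heap_height h)%N.
Proof.
elim: h => [|w0 x0 l IHl r IHr] //.
rewrite [heap_pop _ _]/= val_bind; case: (left_firstT _ _ _).1.
  case: l IHl => [|w y l1 l2] IHl; first by rewrite /=; lia.
  by rewrite val_bind; move: IHl; case: (heap_pop _ _) => h' c /=; lia.
case: r IHr => [|w y l1 l2] IHr; first by rewrite /=; lia.
by rewrite val_bind; move: IHr; case: (heap_pop _ _) => h' c /=; lia.
Qed.

Lemma cost_heap_pop h : ((heap_pop tie h).2 <= 3 * heap_height h)%N.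
Proof.
elim: h => [|w0 x0 l IHl r IHr] //.
rewrite [heap_pop _ _]/= cost_bind; have := cost_left_firstT l r.
case: (left_firstT _ _ _).1.
  case: l IHl => [|w y l1 l2] IHl; first by rewrite /=; lia.
  by rewrite cost_bind; move: IHl; case: (heap_pop _ _) => h' c /=; lia.
case: r IHr => [|w y l1 l2] IHr; first by rewrite /=; lia.
by rewrite cost_bind; move: IHr; case: (heap_pop _ _) => h' c /=; lia.
Qed.

(* Otherwise simplification unfolds a sift of an explicit node. *)
Arguments heap_sift : simpl never.

(** Sifting costs at most six units per level, so the total is bounded by the
    sum of the heights of all subheaps, which is linear in a balanced heap. The
    term with the logarithm is the slack that carries the induction: the two
    halves have heights that differ by at most one, so together they leave
    enough slack to pay for sifting the root. *)
Lemma heap_build_rec_ok (fuel : nat) (e : seq (V * R)) :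
  (size e <= fuel)%N ->
  let m := heap_build_rec tie fuel e in
  [/\ perm_eq (heap_entries m.1) e, heap_ordered m.1,
      (heap_height m.1 <= up_log 2 (size e).+1)%N
    & (m.2 + 6 * up_log 2 (size e).+1 <= 18 * size e)%N].
Proof.
elim: fuel e => [|fuel IH] [|[v x] e] // le_f.
have {}le_f : (size e <= fuel)%N by [].
pose a := (size e)./2.
have -> : heap_build_rec tie fuel.+1 ((v, x) :: e) =
    let* l := heap_build_rec tie fuel (take a e) in
    let* r := heap_build_rec tie fuel (drop a e) in
    heap_sift tie (HNode v x l r) v x by [].
have szt : size (take a e) = a by rewrite size_takel // /a; lia.
have szd : size (drop a e) = (size e - a)%N by rewrite size_drop.
have := IH (take a e); rewrite szt => /(_ ltac:(lia)).
have := IH (drop a e); rewrite szd => /(_ ltac:(lia)).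
case: (heap_build_rec _ _ (drop _ _)) => r cr /= [permR ordR htR cR].
case: (heap_build_rec _ _ (take _ _)) => l cl /= [permL ordL htL cL].
rewrite 2!bindE; change (size ((v, x) :: e)) with (size e).+1; cbn [fst snd].
have up_b : up_log 2 (size e).+2 = (up_log 2 (size e - a).+1).+1.
  by rewrite up_log2S // /a; congr (up_log 2 _).+1; lia.
have up_a : (up_log 2 (size e - a).+1 <= (up_log 2 a.+1).+1)%N.
  by rewrite -up_log2_double // leq_up_log // /a; lia.
have mono : (up_log 2 a.+1 <= up_log 2 (size e - a).+1)%N.
  by rewrite leq_up_log // /a; lia.
have := cost_heap_sift (HNode v x l r) v x.
have := heap_height_sift (HNode v x l r) v x.
have := @perm_heap_sift (HNode v x l r) v x ltac:(by []).
have := @heap_sift_ordered (HNode v x l r) v x; rewrite ordL ordR => /(_ isT).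
move: (heap_sift _ _ _ _) => [h c] /= ordh permh hth ch; split=> //.
- apply: (perm_trans permh); rewrite perm_cons.
  by rewrite -[X in perm_eq _ X](cat_take_drop a) perm_cat.
- by rewrite hth up_b; lia.
- by rewrite up_b; lia.
Qed.

End Heaps.

(** * The data kept by the algorithm *)

Section Algorithm.
Variables (R : realType) (I : instance R).
Local Notation n := (nvert I).
Local Notation V := 'I_n.
Local Notation L := (laplacian (K_of I) (Defs.pi_of I)).
Local Notation depth := (up_log 2 n.+1).
Implicit Types (t : segtree R) (ts : V -> segtree R) (C : V -> seq R)
  (st : state I) (F : {set V}) (u v w : V).

(** [seg_hi t < n] makes a query up to [n] unbounded on the right; [depth] is at
    least the height of a tree with at most [n] entries. *)
Definition tree_fit t : bool :=
  [&& seg_ok t, (seg_height t <= depth)%N & (seg_hi t < n)%N].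

Lemma seg_update_fit t (p : nat) : tree_fit t ->
  tree_fit (seg_update t p 0).1 /\ ((seg_update t p 0).2 <= 2 * depth + 1)%N.
Proof.
case/and3P=> ok ht hi; have [ok' _ hi' ht' [ct _]] := seg_update_ok p 0 ok.
by rewrite /tree_fit ok' ht' hi' ht hi; split=> //; lia.
Qed.

Lemma clear_entries_fit t (ps : seq V) : tree_fit t ->
  let m := clear_entries t ps in
  [/\ tree_fit m.1, (m.2 <= size ps * (2 * depth + 1))%N
    & forall w, w \in ps \/ seg_zero_at t w -> seg_zero_at m.1 w].
Proof.
elim: ps t => [|p ps IH] t fit /=; first by split=> // w [].
have [fit' ct'] := seg_update_fit p fit; have [ok _ _] := and3P fit.
rewrite bindE; have [fit2 c2 zero] := IH _ fit'; split=> //=.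
  by rewrite mulSn leq_add.
move=> w w_zero; apply: zero.
have [->|ne_wp] := eqVneq w p.
  by right; apply: seg_update0_zero => //; left.
case: w_zero => [|w0]; first by rewrite inE (negPf ne_wp) => ?; left.
by right; apply: seg_update0_zero => //; right.
Qed.

Lemma clear_in_trees_fit ts u (vs : seq V) : (forall v, tree_fit (ts v)) ->
  let m := clear_in_trees ts u vs in
  [/\ forall v, tree_fit (m.1 v), (m.2 <= size vs * (2 * depth + 1))%N
    & forall v w, w = u /\ v \in vs \/ seg_zero_at (ts v) w ->
        seg_zero_at (m.1 v) w].
Proof.
elim: vs ts => [|x vs IH] ts fit /=; first by split=> // v w [[]|].
have [fitx cx] := seg_update_fit u (fit x); have [ok _ _] := and3P (fit x).
rewrite bindE; set t := (seg_update (ts x) u 0).1.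
have [|fit2 c2 zero] := IH [eta ts with x |-> t].
  by move=> v /=; case: eqP.
split=> //=; first by rewrite mulSn leq_add.
move=> v w vw; apply: zero; rewrite /=; case: eqP vw => [->|ne_vx] vw.
  right; apply: seg_update0_zero => //.
  by case: vw => [[-> _]|]; [left|right].
case: vw => [[-> ]|w0]; last by right.
by rewrite inE => /orP[/eqP|]; [case/ne_vx|left].
Qed.

Lemma cost_star_entry ts u v : tree_fit (ts v) ->
  ((star_entry ts u v).2 <= 18 * depth + 9)%N.
Proof.
case/and3P=> ok ht hi; rewrite /star_entry !cost_bind.
have := @cost_seg_query _ _ 0 u ok isT.
have := @cost_seg_query _ _ u.+1 n ok; rewrite hi orbT => /(_ isT).
by rewrite [(addT _ _).2]/=; lia.
Qed.

(** The entries at [u] escape both queries. *)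
Lemma star_entry0 ts u v : tree_fit (ts v) ->
  (forall w, w != u -> seg_zero_at (ts v) w) -> (star_entry ts u v).1 = 0.
Proof.
case/and3P=> ok _ hi zero.
have zero_e (e : nat * R) : e \in seg_entries (ts v) -> e.1 != u -> e.2 = 0.
  case: e => p x e_t /= ne_pu.
  have /andP[_ /= le_p] := seg_entries_bounds ok e_t.
  by apply: (zero (Ordinal (leq_ltn_trans le_p hi))).
rewrite /star_entry !val_bind /= !seg_query0 ?addr0 // => e e_t e_u.
  by apply: zero_e => //; lia.
by apply: zero_e => //; lia.
Qed.

(** The substitution forms inner products of dimensions 0, ..., |S| - 1, and
    the final one has dimension |S|; together, |S| (|S| + 1) / 2. *)
Lemma cost_stably_compute_diagonal ts C (S : seq V) u :
  (forall v, tree_fit (ts v)) -> size (C u) = size S ->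
  (forall i, i < size S -> i <= size (C (nth u S i)))%N ->
  let c := (stably_compute_diagonal ts C S u).2 in
  ((size S).+1 * size S <= c <=
     (size S).+1 * size S + 2 * size S + 1 + (size S).+1 * (18 * depth + 9))%N.
Proof.
move=> fit szC rows; rewrite /stably_compute_diagonal.
have cost_star v := cost_star_entry u (fit v).
move: (star_entry ts u) cost_star => star cost_star.
rewrite !cost_bind val_traverse.
have := cost_traverse_le (s := S) (fun v _ => cost_star v); have := cost_star u.
set Ls := map _ S; have szL : size Ls = size S by rewrite size_map.
rewrite (cost_solve (x0 := u)); last first.
  move=> i; rewrite size_zip szL minnn => lt_i.
  by rewrite unzip1_zip ?szL // rows.
rewrite cost_dotT size_solve size_zip szL minnn szC minnn /=; lia.
Qed.

Lemma eq_stably_compute_diagonal ts ts' C C' (S : seq V) u :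
  {in u :: S, ts =1 ts'} -> {in u :: S, C =1 C'} ->
  stably_compute_diagonal ts C S u = stably_compute_diagonal ts' C' S u.
Proof.
move=> eq_ts eq_C; rewrite /stably_compute_diagonal.
have eqS v : v \in S -> v \in u :: S by move=> vS; rewrite inE vS orbT.
have eq_star v : v \in u :: S -> star_entry ts u v = star_entry ts' u v.
  by move=> v_uS; rewrite /star_entry eq_ts.
have -> : traverse (star_entry ts u) S = traverse (star_entry ts' u) S.
  by apply: eq_in_traverse => v /eqS/eq_star.
rewrite eq_star ?mem_head //; move: (star_entry ts' u) => star.
rewrite !bindE eq_C ?mem_head // (@eq_in_solve _ _ C C') // => v.
by rewrite unzip1_zip ?val_traverse ?size_map // => /eqS/eq_C.
Qed.

Lemma stably_compute_diagonal0 ts C (S : seq V) u :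
  (forall v, v \in u :: S -> tree_fit (ts v)) ->
  (forall v w, v \in u :: S -> w != u -> seg_zero_at (ts v) w) ->
  (stably_compute_diagonal ts C S u).1 = 0.
Proof.
move=> fit zero; rewrite /stably_compute_diagonal.
have star0 v : v \in u :: S -> (star_entry ts u v).1 = 0.
  by move=> v_uS; apply: star_entry0 => [|w]; [apply: fit|apply: zero].
move: (star_entry ts u) star0 => star star0; rewrite !val_bind val_traverse.
rewrite star0 ?mem_head //= dotT0 ?subr0 // solve0 //.
apply/allP => x; rewrite unzip2_zip ?size_map //.
by case/mapP=> v vS ->; rewrite star0 // inE vS orbT.
Qed.

(** * One while-iteration *)

Definition row_update st u : cost (seq R) :=
  solve (Crow st) (Crow st u) [seq (s, L u s) | s <- drop (b st u) (sel st)].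

Definition tree_update st u : cost (segtree R) :=
  clear_entries (trees st u) (drop (b st u) (sel st)).

(** The heap is left as it is: an iteration changes it in one of three ways,
    depending on the new key of [u]. *)
Definition refresh st u : state I :=
  State (sel st) [eta Crow st with u |-> (row_update st u).1]
    [eta b st with u |-> size (sel st)] (keys st)
    [eta trees st with u |-> (tree_update st u).1]
    (rcons (jlog st) (size (sel st)).+1) None.

(** The diagonal entry d_u of the current Schur complement, when the row of [u]
    is up to date. *)
Definition residual st u : cost R :=
  stably_compute_diagonal (trees st) (Crow st) (sel st) u.

Definition key_of st u : R := (residual st u).1 / Defs.pi_of I 0 u.

Definition with_keys st (h : heap R V) (o : option V) : state I :=
  State (sel st) (Crow st) (b st) h (trees st) (jlog st) o.

Definition add_vertex st u (d : R) : state I :=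
  State (rcons (sel st) u)
     [eta Crow st with u |-> rcons (Crow st u) (Num.sqrt d)] (b st)
     (heap_pop (@tie _ I) (keys st)).1
     (clear_in_trees (trees st) u (sel st)).1 (jlog st) None.

Lemma iterationE st u x hl hr : keys st = HNode u x hl hr ->
  let st1 := refresh st u in let rho := key_of st1 u in
  let c := ((row_update st u).2 + ((tree_update st u).2 +
     ((residual st1 u).2 +
      (1 + ((ge_rootT rho hl).2 + (ge_rootT rho hr).2)))))%N in
  iteration st =
    if (ge_rootT rho hl).1 && (ge_rootT rho hr).1 then
      if rho < 1 / tmax I then
        (with_keys st1 (HNode u rho hl hr) (Some u), c + 2)%N
      else (add_vertex st1 u (residual st1 u).1,
            c + 3 + (heap_pop (@tie _ I) (keys st)).2
              + (clear_in_trees (trees st1) u (sel st)).2)%N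
    else
      let m := heap_sift (@tie _ I) (keys st) u rho in
      (with_keys st1 m.1 None, c + m.2)%N.
Proof.
case: st => Sj C bs h ts lg ho /= ->.
rewrite /key_of /residual /iteration /refresh /row_update /tree_update.
rewrite /add_vertex /with_keys /bind /divT /ltT /sqrtT /tick.
cbn [sel Crow b keys trees jlog halted fst snd].
case: (solve _ _ _) => Cu c1; cbn [fst snd].
case: (clear_entries _ _) => tu c2; cbn [fst snd].
case: (stably_compute_diagonal _ _ _ _) => d c3; cbn [fst snd].
set rho := d / _; case: (ge_rootT rho hl) => g1 c4.
case: (ge_rootT rho hr) => g2 c5; cbn [fst snd].
case: (g1 && g2); last first.
  case: (heap_sift _ _ _ _) => h' c6 /=; congr (_, _); lia.
case: (rho < _); first by congr (_, _); rewrite /=; lia.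
case: (heap_pop _ _) => h' c6; case: (clear_in_trees _ _ _) => ts2 c7.
by rewrite /= eqxx; congr (_, _); lia.
Qed.
End Algorithm.

(** * The invariant *)

Section Invariant.
Variables (R : realType) (I : instance R).
Local Notation n := (nvert I).
Local Notation V := 'I_n.
Local Notation L := (laplacian (K_of I) (Defs.pi_of I)).
Local Notation depth := (up_log 2 n.+1).
Implicit Types (t : segtree R) (ts : V -> segtree R) (C : V -> seq R)
  (st : state I) (F : {set V}) (u v w : V).

(** The tree of an unselected vertex ignores the selections after its last
    visit, whereas a selected vertex has all selected positions cleared. *)
Record data_inv st : Prop := DataInv {
  row_sel : forall x0 i, (i < size (sel st))%N ->
    size (Crow st (nth x0 (sel st) i)) = i.+1;
  row_unsel : forall v, v \notin sel st -> size (Crow st v) = b st v;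
  b_le : forall v, (b st v <= size (sel st))%N;
  trees_fit : forall v, tree_fit I (trees st v);
  trees_diag : forall v, seg_zero_at (trees st v) v;
  trees_zero : forall v w,
    w \in (if v \in sel st then sel st else take (b st v) (sel st)) ->
    seg_zero_at (trees st v) w
}.

(** [F] holds the vertices whose keys were computed since the last selection;
    their next visit reproduces the same key. *)
Record loop_inv st F : Prop := Inv {
  inv_data : data_inv st;
  inv_perm : perm_eq (sel st ++ unzip1 (heap_entries (keys st))) (enum V);
  inv_ordered : heap_ordered (keys st);
  inv_height : (heap_height (keys st) <= depth)%N;
  inv_size : (size (sel st) < n)%N;
  inv_fresh : forall v x, v \in F -> (v, x) \in heap_entries (keys st) ->
    b st v = size (sel st) /\ x = key_of st v
}.

Lemma cost_row_update st u : data_inv st -> u \notin sel st ->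
  ((row_update st u).2 <= (size (sel st)).+1 * size (sel st))%N.
Proof.
move=> inv u_sel; rewrite /row_update.
have le_b := b_le inv u; rewrite (cost_solve (x0 := u)).
  rewrite size_map size_drop (row_unsel inv u_sel).
  by move: (b st u) (size (sel st)) le_b => p q; nia.
move=> i; rewrite size_map size_drop (row_unsel inv u_sel) => lt_i.
rewrite /unzip1 -map_comp (nth_map u) ?size_drop // nth_drop /=.
by rewrite (row_sel inv) //; lia.
Qed.

Lemma refresh_data_inv st u : data_inv st -> u \notin sel st ->
  data_inv (refresh st u).
Proof.
move=> inv u_sel; have le_b := b_le inv u.
have [fit _ zero] :=
  clear_entries_fit (drop (b st u) (sel st)) (trees_fit inv u).
split=> /=.
- move=> x0 i lt_i; case: eqP => [eq_u|_]; last exact: row_sel.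
  by rewrite -eq_u mem_nth in u_sel.
- move=> v v_sel; case: eqP => [_|_]; last exact: row_unsel.
  rewrite /row_update size_solve size_map size_drop (row_unsel inv u_sel).
  by rewrite subnKC.
- by move=> v; case: eqP => // _; apply: b_le.
- by move=> v; case: eqP => // _; apply: trees_fit.
- move=> v; case: eqP => [->|_]; last exact: trees_diag.
  by apply: zero; right; apply: trees_diag.
- move=> v w; case: eqP => [->|_]; last exact: trees_zero.
  rewrite (negPf u_sel) take_size -{1}(cat_take_drop (b st u) (sel st)) mem_cat.
  move=> w_sel; apply: zero; case/orP: w_sel => [w_take|]; last by left.
  by right; apply: trees_zero; rewrite // (negPf u_sel).
Qed.

Lemma add_vertex_data_inv st u d : data_inv st -> u \notin sel st ->
  b st u = size (sel st) -> data_inv (add_vertex st u d).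
Proof.
move=> inv u_sel b_u.
have [fit _ zero] := clear_in_trees_fit u (sel st) (trees_fit inv).
split=> /=.
- move=> x0 i; rewrite size_rcons ltnS nth_rcons => le_i.
  case: ltngtP le_i => // [lt_i|->] _.
    case: eqP => [eq_u|_]; last exact: row_sel.
    by rewrite -eq_u mem_nth in u_sel.
  by rewrite eqxx size_rcons row_unsel // b_u.
- move=> v; rewrite mem_rcons inE negb_or => /andP[/negPf-> v_sel].
  exact: row_unsel.
- by move=> v; rewrite size_rcons (leq_trans (b_le inv v)).
- exact: fit.
- by move=> v; apply: zero; right; apply: trees_diag.
- move=> v w; rewrite mem_rcons inE.
  have take_b : take (b st v) (rcons (sel st) u) = take (b st v) (sel st).
    by rewrite -cats1 takel_cat // b_le.
  case: eqP => [->|_] /=; last first.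
    rewrite take_b; case: ifP => v_sel w_v.
      move: w_v; rewrite mem_rcons inE => /orP[/eqP->|w_sel].
        by apply: zero; left.
      by apply: zero; right; apply: trees_zero; rewrite ?v_sel.
    by apply: zero; right; apply: trees_zero; rewrite ?v_sel.
  rewrite mem_rcons inE => /orP[/eqP->|w_sel]; apply: zero; right.
    exact: trees_diag.
  by apply: trees_zero; rewrite // (negPf u_sel) b_u take_size.
Qed.

Lemma key_of_refresh st u v : u \notin sel st -> v != u ->
  key_of (refresh st u) v = key_of st v.
Proof.
move=> u_sel ne_vu; rewrite /key_of /residual.
rewrite (@eq_stably_compute_diagonal _ _ _ (trees st) _ (Crow st)) // => w /=;
  rewrite inE; case: (w =P u) => // -> /orP[/eqP eq_uv|/(negP u_sel)//];
  by rewrite eq_uv eqxx in ne_vu.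
Qed.

(** Without a selection since the last visit, there is nothing to append to the
    row and nothing to clear in the tree. *)
Lemma key_of_refresh_current st u : b st u = size (sel st) ->
  key_of (refresh st u) u = key_of st u.
Proof.
move=> b_u; rewrite /key_of /residual.
rewrite (@eq_stably_compute_diagonal _ _ _ (trees st) _ (Crow st)) // => w _ /=;
  case: eqP => // ->.
  by rewrite /tree_update b_u drop_size.
by rewrite /row_update b_u drop_size.
Qed.

(** When a single vertex is left, every tree is zero away from it, so all the
    sums that enter the Schur complement vanish. The value 0 that results is
    the last Schur complement of a singular matrix; it makes the algorithm
    halt. *)
Lemma residual_last st u : data_inv st -> u \notin sel st ->
  b st u = size (sel st) -> (forall w, w != u -> w \in sel st) ->
  (residual st u).1 = 0.
Proof.
move=> inv u_sel b_u last_u; apply: stably_compute_diagonal0 => [v _|v w].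
  exact: trees_fit.
rewrite inE => /orP[/eqP->|v_sel] ne_wu; apply: trees_zero => //.
  by rewrite (negPf u_sel) b_u take_size last_u.
by rewrite v_sel last_u.
Qed.

Lemma mem_keys st F v : loop_inv st F ->
  (v \in unzip1 (heap_entries (keys st))) = (v \notin sel st).
Proof.
move=> inv; have := inv_perm inv => perm.
have : uniq (sel st ++ unzip1 (heap_entries (keys st))).
  by rewrite (perm_uniq perm) enum_uniq.
rewrite cat_uniq => /and3P[_ /hasPn disj _].
have := perm_mem perm v; rewrite mem_cat mem_enum => v_in.
have [v_key|v_key] := boolP (v \in unzip1 _); first by rewrite disj.
by move: v_in; rewrite (negPf v_key) orbF => ->.
Qed.

Lemma size_keys st F : loop_inv st F ->
  (size (sel st) + size (heap_entries (keys st)) = n)%N.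
Proof.
move=> inv; have := perm_size (inv_perm inv).
by rewrite size_cat size_map -cardE card_ord.
Qed.

Lemma keys_node st F : loop_inv st F ->
  exists u x hl hr, keys st = HNode u x hl hr /\ u \notin sel st.
Proof.
move=> inv; have := size_keys inv; have := inv_size inv.
have := mem_keys _ inv; case: (keys st) => [|u x hl hr] mem_u /=; first by lia.
by move=> _ _; exists u, x, hl, hr; split=> //; rewrite -mem_u mem_head.
Qed.

Lemma iteration_jlog st F : loop_inv st F ->
  jlog (iteration st).1 = rcons (jlog st) (size (sel st)).+1.
Proof.
move=> inv; have [u [x [hl [hr [eq_h _]]]]] := keys_node inv.
by rewrite (iterationE eq_h); case: ifP => //= _; case: ifP.
Qed.

Lemma iteration_sel st F : loop_inv st F ->
  (size (sel st) <= size (sel (iteration st).1))%N.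
Proof.
move=> inv; have [u [x [hl [hr [eq_h _]]]]] := keys_node inv.
rewrite (iterationE eq_h); case: ifP => //= _; case: ifP => //= _.
by rewrite size_rcons.
Qed.

Lemma iteration_b st F : loop_inv st F ->
  exists u, forall v,
    b (iteration st).1 v = if v == u then size (sel st) else b st v.
Proof.
move=> inv; have [u [x [hl [hr [eq_h _]]]]] := keys_node inv; exists u => v.
by rewrite (iterationE eq_h); case: ifP => //= _; case: ifP.
Qed.

Lemma depth_gt0 v : (0 < depth)%N.
Proof. by rewrite up_log_gt0 /= ltnS; case: v => p; case: n. Qed.

(** The lower bound is the cost of the inner products for the diagonal entry.
    Above it there are the inner products of the row update, of no larger total
    dimension, and O(j) operations on trees and O(1) on the heap, of cost
    O(depth) each. *)
Lemma cost_iteration st F : loop_inv st F ->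
  let j := (size (sel st)).+1 in
  (j * j.-1 <= (iteration st).2 <= 2 * (j * j.-1) + 48 * (j * depth))%N.
Proof.
move=> inv; have [u [x [hl [hr [eq_h u_sel]]]]] := keys_node inv.
have dinv := inv_data inv; have dinv1 := refresh_data_inv dinv u_sel.
have d_gt0 := depth_gt0 u.
have c_row := cost_row_update dinv u_sel.
have [_ c_tree _] :=
  clear_entries_fit (drop (b st u) (sel st)) (trees_fit dinv u).
have b_u : b (refresh st u) u = size (sel st) by rewrite /= eqxx.
have c_diag := cost_stably_compute_diagonal (trees_fit dinv1)
  (etrans (row_unsel dinv1 u_sel) b_u)
  (fun i lt_i => leq_trans (leqnSn i) (eq_leq (esym (row_sel dinv1 u lt_i)))).
have c_ge (z : R) (h : heap R V) : ((ge_rootT z h).2 <= 1)%N by case: h.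
have [_ c_clear _] := clear_in_trees_fit u (sel st) (trees_fit dinv1).
have c_pop := cost_heap_pop (@tie _ I) (keys st).
have c_sift := cost_heap_sift (@tie _ I) (keys st) u (key_of (refresh st u) u).
have ht := inv_height inv; rewrite (iterationE eq_h).
have := c_ge (key_of (refresh st u) u) hl.
have := c_ge (key_of (refresh st u) u) hr.
have {}c_tree : ((tree_update st u).2 <= size (sel st) * (2 * depth + 1))%N.
  by apply: leq_trans c_tree _; rewrite leq_mul2r size_drop leq_subr orbT.
move: c_row c_tree c_diag c_clear c_pop c_sift.
rewrite -/(residual (refresh st u) u).
change (sel (refresh st u)) with (sel st).
move: (heap_sift _ _ _ _) (heap_pop _ _) (clear_in_trees _ _ _) => h1 h2 ts1.
move: (row_update _ _).2 (tree_update _ _).2 (residual _ _).2 => c1 c2 c3.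
move: (ge_rootT _ hl).2 (ge_rootT _ hr).2 => c4 c5.
move: (heap_height _) (size (sel st)) depth ht d_gt0 => hh s d ht d_gt0.
have le_sd : (s <= s * d)%N by rewrite leq_pmulr.
move=> c1_le c2_le /= c3_le c7_le c6_le c8_le c5_le c4_le.
by case: ifP => _; [case: ifP => _|]; rewrite /=; lia.
Qed.

(** As [#|F| <= n], a selection decreases it although the fresh vertices are
    lost. *)
Definition measure st F : nat := (n - size (sel st)) * n.+1 - #|F|.

Hypothesis tmax_gt0 : 0 < tmax I.

(** Either the algorithm halts, or a vertex is selected, or the visited vertex
    becomes fresh. In the last case it was not fresh before: a fresh root
    recovers its own key, which dominates the heap, and is selected. *)
Lemma iteration_progress st F : loop_inv st F ->
  let st' := (iteration st).1 in
  halted st' <> None /\ sel st' = sel st \/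
  halted st' = None /\
    exists F', loop_inv st' F' /\ (measure st' F' < measure st F)%N.
Proof.
move=> inv; have [u [x [hl [hr [eq_h u_sel]]]]] := keys_node inv.
have dinv := inv_data inv; have dinv1 := refresh_data_inv dinv u_sel.
have b_u : b (refresh st u) u = size (sel st) by rewrite /= eqxx.
have ord := inv_ordered inv; have ht := inv_height inv.
have szF := inv_size inv.
have perm := inv_perm inv.
have card_le (A : {set V}) : (#|A| <= n)%N.
  by rewrite -[leqRHS]card_ord max_card.
have card_F := card_le F; rewrite (iterationE eq_h) /=.
set rho := key_of (refresh st u) u; case: ifP => [_|no_fit] /=.
  case: ifP => [_|go_on]; first by left.
  right; split=> //; exists set0.
  have lt_s : ((size (sel st)).+1 < n)%N.
    rewrite ltn_neqAle szF andbT; apply: contraFneq go_on => last_u.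
    rewrite /rho /key_of residual_last ?mul0r ?mul1r ?invr_gt0 // => w ne_wu.
    have := size_keys inv; have := mem_keys w inv; rewrite eq_h /=.
    rewrite inE (negPf ne_wu) => w_in sz.
    have /nilP nil : nilp (heap_entries hl ++ heap_entries hr).
      rewrite /nilp -eqSS; apply/eqP/(@addnI (size (sel st))).
      by apply: (etrans sz); rewrite addn1.
    by move: w_in; rewrite nil => /esym/negbFE.
  split.
    split=> /=.
    - exact: add_vertex_data_inv.
    - rewrite cat_rcons; apply: perm_trans perm; rewrite perm_cat2l eq_h /=.
      rewrite perm_cons.
      exact: (perm_map fst (perm_heap_pop _ (HNode u x hl hr))).
    - by rewrite (heap_pop_ordered _ ord).1.
    - exact: leq_trans (heap_height_pop _ _) ht.
    - by rewrite size_rcons.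
    - by move=> v y; rewrite inE.
  rewrite /measure /= size_rcons cards0 subn0.
  have -> : (n - size (sel st) = (n - (size (sel st)).+1).+1)%N by lia.
  by rewrite mulSn ltn_subRL ltn_add2r ltnS.
have u_F : u \notin F.
  apply: contraFN no_fit => u_F.
  have [b_cur eq_x] : b st u = size (sel st) /\ x = key_of st u.
    by apply: (inv_fresh inv u_F); rewrite eq_h mem_head.
  rewrite /rho key_of_refresh_current // -eq_x.
  by move: ord; rewrite eq_h /= => /and4P[-> ->].
right; split=> //; exists (u |: F).
have permh := perm_heap_sift (@tie _ I) u rho (h := keys st)
  ltac:(by rewrite eq_h).
have tail_u v y : (v, y) \in behead (heap_entries (keys st)) ->
    v != u /\ (v, y) \in heap_entries (keys st).
  have : uniq (unzip1 (heap_entries (keys st))).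
    have : uniq (sel st ++ unzip1 (heap_entries (keys st))).
      by rewrite (perm_uniq perm) enum_uniq.
    by rewrite cat_uniq => /and3P[].
  rewrite eq_h /= => /andP[u_notin _] vy; rewrite inE vy orbT; split=> //.
  by apply: contraNneq u_notin => <-; apply: (map_f fst vy).
split.
  split=> //=.
  - by case: dinv1 => *; split.
  - apply: perm_trans perm; rewrite perm_cat2l.
    by apply: (perm_trans (perm_map fst permh)); rewrite eq_h perm_refl.
  - apply: heap_sift_ordered; rewrite eq_h in ord *.
    by case/and4P: ord => _ _ ol or; apply/andP.
  - by rewrite heap_height_sift.
  - move=> v y v_F; rewrite (perm_mem permh) inE; case/orP=> [/eqP[-> ->]|].
      by rewrite eqxx.
    case/tail_u=> ne_vu vy; move: v_F; rewrite (negPf ne_vu).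
    rewrite in_setU1 (negPf ne_vu) /= => v_F.
    have [b_v ->] := inv_fresh inv v_F vy.
    by split=> //; rewrite -(key_of_refresh u_sel ne_vu).
rewrite /measure /= cardsU1 u_F.
have := card_le (u |: F); rewrite cardsU1 u_F /= => card_uF.
apply: ltn_sub2l; last by rewrite add1n.
apply: (@leq_trans n.+1); first by rewrite ltnS card_F.
by rewrite leq_pmull // subn_gt0.
Qed.
End Invariant.

(** * Initialization *)

Section Initialization.
Variables (R : realType) (I : instance R).
Local Notation n := (nvert I).
Local Notation V := 'I_n.
Local Notation L := (laplacian (K_of I) (Defs.pi_of I)).
Local Notation depth := (up_log 2 n.+1).
Implicit Types (st : state I) (F : {set V}) (u v w : V).
Hypotheses (n_gt0 : (0 < n)%N) (pi_gt0 : forall v, 0 < Defs.pi_of I 0 v).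

Lemma laplacian_neq0 w v : (L w v != 0) = (K_of I w v != 0).
Proof.
rewrite /laplacian mxE oppr_eq0 mul_mx_diag mxE mulf_eq0.
by rewrite (gt_eqF (pi_gt0 v)) orbF.
Qed.

Lemma unzip1_column v :
  unzip1 (column v) = [seq val w | w <- enum V & (w != v) && (L w v != 0)].
Proof. by rewrite /unzip1 /column -map_comp; apply: eq_map. Qed.

Lemma sorted_column v : sorted ltn (unzip1 (column v)).
Proof.
rewrite unzip1_column; apply: (subseq_sorted ltn_trans) (iota_ltn_sorted 0 n).
by rewrite -val_enum_ord map_subseq // filter_subseq.
Qed.

Lemma size_column v :
  size (column v) = (\sum_w ((w != v) && (K_of I w v != 0%R)))%N.
Proof.
rewrite size_map size_filter -sum1_count big_mkcond big_enum /=.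
by apply: eq_bigr => w _; rewrite laplacian_neq0; case: (_ && _).
Qed.

Lemma nnzE : nnz (K_of I) = (\sum_v \sum_w (K_of I w v != 0%R))%N.
Proof.
rewrite /nnz -sum1dep_card big_mkcond /= exchange_big pair_bigA /=.
by apply: eq_bigr => p _; case: (_ == _).
Qed.

Lemma nnz_le_size_columns :
  (nnz (K_of I) <= \sum_(v : V) size (column v) + n)%N.
Proof.
rewrite nnzE -[X in (_ + X)%N](card_ord n) -sum1_card -big_split /=.
apply: leq_sum => v _; rewrite size_column (bigD1 v) //=.
rewrite [X in (_ <= X + _)%N](bigD1 v) //=.
rewrite eqxx /= add0n addnC leq_add ?leq_b1 //.
by apply: leq_sum => w ->.
Qed.

Lemma size_columns_le_nnz : (\sum_(v : V) size (column v) <= nnz (K_of I))%N.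
Proof.
rewrite nnzE; apply: leq_sum => v _; rewrite size_column.
by apply: leq_sum => w _; case: (w != v); case: (_ != 0).
Qed.

Lemma size_column_le v : (size (column v) <= n)%N.
Proof.
by rewrite size_map size_filter (leq_trans (count_size _ _)) ?size_enum_ord.
Qed.

Lemma initial_tree v : let t := seg_build (column v) in
  [/\ tree_fit I t.1, seg_zero_at t.1 v
    & (size (column v) <= t.2 <= 2 * size (column v))%N].
Proof.
have [ent ok ht ct lohi] := seg_build_rec_ok (leqnn _) (sorted_column v).
split; first 1 last.
- move=> x; rewrite /seg_build ent => /mapP[w]; rewrite mem_filter.
  by case/andP=> /andP[/eqP ne_wv _] _ [/val_inj eq_vw _]; case: ne_wv.
- by move: ct; rewrite /seg_build; lia.
rewrite /tree_fit ok (leq_trans ht) ?leq_up_log //=; last first.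
  by rewrite (leq_trans (size_column_le v)).
have [nil|ne] := eqVneq (column v) [::]; first by rewrite /seg_build nil.
have [_ ->] := lohi ne.
have : last (0%N, 0) (column v) \in column v.
  by case: (column v) ne => //= e s _; rewrite mem_last.
by case/mapP=> w _ ->; apply: ltn_ord.
Qed.

(** The diagonal entries of [K], which are not stored in the trees, are paid for
    by the computation of the initial keys. *)
Lemma initialize_ok :
  [/\ loop_inv (initialize I).1 set0,
      sel (initialize I).1 = [::] /\ jlog (initialize I).1 = [::],
      halted (initialize I).1 = None,
      b (initialize I).1 =1 (fun=> 0%N)
    & (nnz (K_of I) <= (initialize I).2 <= 2 * nnz (K_of I) + 19 * n)%N].
Proof.
rewrite /initialize !bindE !val_traverse; cbn [fst snd sel jlog b halted].
have := @heap_build_rec_ok _ _ (@tie _ I) _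
  [seq ((let* r := divT (L v v) (Defs.pi_of I 0 v) in ret (v, r)) : cost _).1
     | v <- enum V] (leqnn _).
rewrite -/(heap_build _ _) size_map size_enum_ord.
set h := heap_build _ _; case: h => h ch /= [perm ord ht c_heap].
have nth_tree v : nth SegEmpty [seq (seg_build (column x)).1 | x <- enum V] v =
    (seg_build (column v)).1.
  by rewrite (nth_map v) ?size_enum_ord // nth_ord_enum.
split=> //.
  split=> //=.
  - split=> //= v; rewrite nth_tree; first by have [] := initial_tree v.
    by have [] := initial_tree v.
  - apply: (perm_trans (perm_map fst perm)); rewrite -map_comp map_id_in //.
  - by move=> v x; rewrite inE.
rewrite !cost_traverse !big_enum /=.
have -> : (\sum_(v : V)
    (let* r := divT (L v v) (Defs.pi_of I 0%R v) in ret (v, r)).2 = n)%N.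
  by rewrite sum1_card card_ord.
have := nnz_le_size_columns; have := size_columns_le_nnz.
have : (\sum_(v : V) size (column v) <=
    \sum_(v : V) (seg_build (column v)).2)%N.
  by apply: leq_sum => v _; have [_ _ /andP[]] := initial_tree v.
have : (\sum_(v : V) (seg_build (column v)).2 <=
    \sum_(v : V) 2 * size (column v))%N.
  by apply: leq_sum => v _; have [_ _ /andP[]] := initial_tree v.
rewrite -big_distrr /=; move: c_heap.
move: (\sum_v size _)%N (\sum_v _)%N (nnz _) => A B N; lia.
Qed.
End Initialization.

(** * Runs of the algorithm *)

Section Run.
Variables (R : realType) (I : instance R).
Local Notation n := (nvert I).
Local Notation V := 'I_n.
Local Notation depth := (up_log 2 n.+1).
Implicit Types (st : state I) (F : {set V}).
Hypothesis tmax_gt0 : 0 < tmax I.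

(** Twice [M_diag], as a sum over the iterations. It dominates twice
    [M_offdiag], since an update of [b u] to j - 1 is part of an iteration with
    index j. *)
Definition diag_work st : nat := (\sum_(j <- jlog st) j * j.-1)%N.
Definition index_sum st : nat := (\sum_(j <- jlog st) j)%N.

Record counters_inv st : Prop := CountersInv {
  sel_lt : (size (sel st) < n)%N;
  jlog_range : forall j : nat, j \in jlog st -> (0 < j <= (size (sel st)).+1)%N;
  offdiag_le : (\sum_v b st v * (b st v).-1 <= diag_work st)%N
}.

Lemma iteration_counters st F : loop_inv st F -> counters_inv st ->
  counters_inv (iteration st).1.
Proof.
move=> inv [lt_s range offdiag].
have le_sel := iteration_sel inv; split.
- have [[_ ->]|[_ [F' [inv' _]]]] // := iteration_progress tmax_gt0 inv.
  exact: inv_size inv'.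
- move=> j; rewrite (iteration_jlog inv) mem_rcons inE => /orP[/eqP->//|/range].
  by move=> /andP[-> /= le_j]; apply: leq_trans le_j _.
- rewrite /diag_work (iteration_jlog inv) big_rcons /= -/(diag_work st).
  have [u b_upd] := iteration_b inv.
  rewrite (bigD1 u) //= b_upd eqxx.
  rewrite [X in (_ + X)%N](eq_bigr (fun v => b st v * (b st v).-1)%N).
    have := offdiag; rewrite (bigD1 u) //=.
    move: (b st u * _)%N (\sum_(v | _) _)%N => ? ?.
    by case: (size _) => [|s] /=; lia.
  by move=> v /negPf ne_vu; rewrite b_upd ne_vu.
Qed.

Lemma iterate_counters fuel st F : loop_inv st F -> counters_inv st ->
  halted st = None ->
  let m := iterate fuel st in
  [/\ counters_inv m.1, (diag_work m.1 <= diag_work st + m.2)%N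
    & (m.2 + 2 * diag_work st + 48 * (index_sum st * depth) <=
       2 * diag_work m.1 + 48 * (index_sum m.1 * depth))%N].
Proof.
elim: fuel st F => [|fuel IH] st F inv cnt.
  by move=> _ /=; split=> //; lia.
move=> no_halt; rewrite /= no_halt bindE /=.
have := cost_iteration inv; rewrite /= => c_it.
have cnt' := iteration_counters inv cnt; have log' := iteration_jlog inv.
have diag' : diag_work (iteration st).1 =
    (diag_work st + (size (sel st)).+1 * size (sel st))%N.
  by rewrite /diag_work log' big_rcons /=; lia.
have index' : index_sum (iteration st).1 =
    (index_sum st + (size (sel st)).+1)%N.
  by rewrite /index_sum log' big_rcons /=; lia.
have [[halt _]|[no_halt' [F' [inv' _]]]] := iteration_progress tmax_gt0 inv.
  have -> : iterate fuel (iteration st).1 = ((iteration st).1, 0%N).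
    by case: fuel {IH} => //= fuel; case: (halted _) halt.
  by split=> //=; rewrite diag' ?index'; lia.
have := IH _ _ inv' cnt' no_halt'; case: (iterate _ _) => st' c /= [? d1 d2].
by split=> //; rewrite diag' ?index' in d1 d2; lia.
Qed.

Lemma iterate_halts st F : loop_inv st F -> halted st = None ->
  exists fuel, halted (iterate fuel st).1 <> None.
Proof.
move: {2}(measure st F).+1 (ltnSn (measure st F)) => m.
elim: m st F => // m IH st F lt_m inv no_halt.
have [[halt _]|[no_halt' [F' [inv' lt_F]]]] := iteration_progress tmax_gt0 inv.
  exists 1%N; rewrite /= no_halt val_bind.
  by case: (halted _) halt.
have [|fuel halt] := IH _ F' _ inv' no_halt'; first exact: leq_trans lt_F _.
by exists fuel.+1; rewrite /= no_halt val_bind.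
Qed.
End Run.

(** * From bounds to asymptotics *)

Lemma sum_count_mem (f : nat -> nat) (s : seq nat) (p q : nat) :
  (forall j : nat, j \in s -> (p <= j < q)%N) ->
  (\sum_(p <= j < q) f j * count_mem j s = \sum_(j <- s) f j)%N.
Proof.
elim: s => [|x s IH] range.
  by rewrite big_nil big1 // => j _; rewrite muln0.
rewrite big_cons -IH => [|j j_s]; last by apply: range; rewrite inE j_s orbT.
have x_pq : x \in index_iota p q by rewrite mem_index_iota range ?mem_head.
rewrite !(bigD1_seq x) ?iota_uniq //= eqxx addnA -mulnS; congr (_ + _)%N.
by apply: eq_bigr => j /negPf; rewrite eq_sym => ->.
Qed.

Section Counting.
Variables (R : realType) (I : instance R) (st : state I).
Local Notation k := (k_of st).
Local Notation n := (nvert I).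
Hypothesis cnt : counters_inv st.

Lemma range_jlog (j : nat) : j \in jlog st -> (1 <= j < k.+2)%N.
Proof. exact: jlog_range. Qed.

Lemma diag_workE :
  diag_work st = (\sum_(1 <= j < k.+2) j * j.-1 * iter_count st j)%N.
Proof. exact: esym (sum_count_mem (fun j => j * j.-1)%N range_jlog). Qed.

Lemma index_sumE :
  index_sum st = (\sum_(1 <= j < k.+2) j * iter_count st j)%N.
Proof. exact: esym (sum_count_mem id range_jlog). Qed.

Lemma natrM_pred (m : nat) : (m * m.-1)%:R = m%:R * (m%:R - 1) :> R.
Proof.
case: m => [|m]; first by rewrite mul0r.
by rewrite natrM /=; congr (_ * _); rewrite -addn1 natrD addrK.
Qed.

Lemma M_diagE : M_diag st = 2^-1 * (diag_work st)%:R.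
Proof.
rewrite diag_workE natr_sum; congr (_ * _); apply: eq_bigr => j _.
by rewrite natrM natrM_pred.
Qed.

Lemma M_offdiag_bounds : 0 <= M_offdiag st <= M_diag st.
Proof.
have -> : M_offdiag st = 2^-1 * (\sum_v b st v * (b st v).-1)%N%:R.
  by rewrite natr_sum; congr (_ * _); apply: eq_bigr => v _; rewrite natrM_pred.
rewrite M_diagE ler_pM2l ?invr_gt0 // ler_nat offdiag_le // andbT.
by rewrite mulr_ge0 ?invr_ge0.
Qed.

Lemma index_sum_natr :
  \sum_(1 <= j < k.+2) j%:R * (iter_count st j)%:R = (index_sum st)%:R :> R.
Proof.
by rewrite index_sumE natr_sum; apply: eq_bigr => j _; rewrite natrM.
Qed.

Lemma lazy_best_bounds : lazy_best st ->
  [/\ (k ^ 3 <= 12 * diag_work st)%N, (diag_work st <= 2 * k ^ 3)%N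
    & (index_sum st <= 1 + 2 * k ^ 2)%N].
Proof.
move=> best; rewrite diag_workE index_sumE.
have -> : (\sum_(1 <= j < k.+2) j * j.-1 * iter_count st j =
    \sum_(1 <= j < k.+2) j * j.-1)%N.
  by apply: eq_big_nat => j /best->; rewrite muln1.
have -> : (\sum_(1 <= j < k.+2) j * iter_count st j = \sum_(1 <= j < k.+2) j)%N.
  by apply: eq_big_nat => j /best->; rewrite muln1.
have diagE m : (3 * \sum_(1 <= j < m.+2) j * j.-1 = m * m.+1 * m.+2)%N.
  elim: m => [|m IH]; first by rewrite big_nat1.
  by rewrite big_nat_recr //= mulnDr IH; lia.
have indexE m : (2 * \sum_(1 <= j < m.+2) j = m.+1 * m.+2)%N.
  elim: m => [|m IH]; first by rewrite big_nat1.
  by rewrite big_nat_recr //= mulnDr IH; lia.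
have := diagE k; have := indexE k.
move: (\sum_(_ <= _ < _) _)%N => A; move: (\sum_(_ <= _ < _) _)%N => B.
move: k => m.
by rewrite !expnS !expn0 => eqA eqB; split; case: m eqA eqB => [|m]; nia.
Qed.

(** The closed form of [diag_work] is k (k+1) (k+2) (4n - 3k - 1) / 12, and the
    last factor lies between n and 4n because k < n. *)
Lemma lazy_worst_bounds : lazy_worst st ->
  [/\ (k ^ 3 * n <= 12 * diag_work st)%N, (diag_work st <= 2 * (k ^ 3 * n))%N
    & (index_sum st <= 1 + 2 * (k ^ 2 * n))%N].
Proof.
case=> c1 cj _; rewrite diag_workE index_sumE.
have lt_kn : (k < n)%N := sel_lt cnt.
have -> : (\sum_(1 <= j < k.+2) j * j.-1 * iter_count st j =
    \sum_(1 <= j < k.+2) j * j.-1 * (n - j + 1))%N.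
  apply: eq_big_nat => -[|[|j]] // lt_j.
  by rewrite cj.
have -> : (\sum_(1 <= j < k.+2) j * iter_count st j =
    1 + \sum_(2 <= j < k.+2) j * (n - j + 1))%N.
  rewrite big_ltn // c1; congr (_ + _)%N.
  by apply: eq_big_nat => j lt_j; rewrite cj.
have diagE m : (m < n)%N ->
    (12 * \sum_(1 <= j < m.+2) j * j.-1 * (n - j + 1) +
       m * m.+1 * m.+2 * (3 * m + 1) = 4 * n * (m * m.+1 * m.+2))%N.
  elim: m => [|m IH] lt_mn; first by rewrite big_nat1; lia.
  have /subnKC n_eq := lt_mn; move: IH => /(_ (ltnW lt_mn)).
  rewrite [in X in _ -> X]big_nat_recr //= mulnDr.
  move: (\sum_(_ <= _ < _) _)%N => A.
  by move: (n - m.+2)%N n_eq => p <-; lia.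
have index_le m : (m < n)%N ->
    (2 * \sum_(2 <= j < m.+2) j * (n - j + 1) <= n * (m * (m + 3)))%N.
  elim: m => [|m IH] lt_mn; first by rewrite big_geq.
  have := IH (ltnW lt_mn); rewrite [in X in _ -> X]big_nat_recr //= mulnDr.
  move: (\sum_(_ <= _ < _) _)%N => A.
  have : (n - m.+2 + 1 <= n)%N by lia.
  move: (n - m.+2 + 1)%N => p; nia.
have := diagE _ lt_kn; have := index_le _ lt_kn.
move: (\sum_(_ <= _ < _) _)%N => A; move: (\sum_(_ <= _ < _) _)%N => B.
move: k n lt_kn => m N lt_mN.
rewrite !expnS !expn0 !muln1 => leA eqB.
set Q := (m * m.+1 * m.+2)%N in eqB.
have le_mQ : (m * (m * m) <= Q)%N by rewrite /Q; nia.
have le_Qm : (Q <= 6 * (m * (m * m)))%N by rewrite /Q; case: (m) => [|m']; nia.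
have le_Q3 : (Q * (3 * m + 1) <= 3 * (Q * N))%N.
  by rewrite mulnCA leq_mul2l; apply/orP; right; lia.
have le_mQN : (m * (m * m) * N <= Q * N)%N by rewrite leq_mul2r le_mQ orbT.
have le_QmN : (Q * N <= 6 * (m * (m * m)) * N)%N.
  by rewrite leq_mul2r le_Qm orbT.
have le_mm : (N * (m * (m + 3)) <= N * (4 * (m * m)))%N.
  by rewrite leq_mul2l; apply/orP; right; case: (m) => [|m']; nia.
have eqQN : (4 * N * Q = 4 * (Q * N))%N by rewrite -mulnA (mulnC N).
move: (Q * (3 * m + 1))%N (Q * N)%N eqB le_Q3 le_mQN le_QmN eqQN => X Y.
by move=> eqB le_Q3 le_mQN le_QmN eqQN; split; lia.
Qed.
End Counting.

Lemma up_log_le_ln (R : realType) (n : nat) : (1 < n)%N ->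
  (up_log 2 n.+1)%:R <= 2 / ln 2 * ln n%:R :> R.
Proof.
move=> n_gt1; set d := up_log 2 n.+1.
have ln2_gt0 : 0 < ln (2 : R) by rewrite ln_gt0 // ltr1n.
have lt_d : (2 ^ d.-1 <= n)%N by rewrite -ltnS up_log_gtn ?ltnS ?(ltnW n_gt1).
have d_gt0 : (0 < d)%N by rewrite up_log_gt0 /= ltnS (ltnW n_gt1).
have ln_d : d.-1%:R * ln 2 <= ln n%:R :> R.
  rewrite mulr_natl -lnXn // ler_ln ?posrE ?exprn_gt0 ?ltr0n //.
    by rewrite -natrX ler_nat.
  exact: ltn_trans n_gt1.
have ln_2 : ln 2 <= ln n%:R :> R.
  by rewrite ler_ln ?posrE ?ltr0n ?ler_nat // (ltn_trans _ n_gt1).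
rewrite mulrAC ler_pdivlMr // -(prednK d_gt0) -addn1 natrD; lra.
Qed.

Lemma up_log_le (n : nat) : (up_log 2 n.+1 <= n)%N.
Proof.
case: n => // n; have := @up_log_gtn 2 n.+2 isT isT; set d := up_log _ _.
by have := ltn_expl d.-1 (ltnSn 1); lia.
Qed.

(** The time is split at [c2 * A]: what exceeds it is at most [c3 * B]. *)
Lemma time_Theta_plus_O_of_bounds (R : realType)
    (P : forall I : instance R, state I -> Prop)
    (A B : forall I : instance R, state I -> R) (c1 c2 c3 : R) :
  0 < c1 -> c1 <= c2 -> 0 < c3 ->
  (forall (I : instance R) (st : state I) (t : nat),
     P I st -> terminates_in st t ->
     [/\ 0 <= A I st, 0 <= B I st
       & c1 * A I st <= t%:R <= c2 * A I st + c3 * B I st]) ->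
  time_Theta_plus_O P A B.
Proof.
move=> c1_gt0 c12 c3_gt0 bounds; exists c1, c2, c3.
split=> // [|I st t P_st term]; first exact: lt_le_trans c1_gt0 c12.
have [A_ge0 B_ge0 /andP[lo hi]] := bounds I st t P_st term.
exists (Num.min t%:R (c2 * A I st)), (t%:R - Num.min t%:R (c2 * A I st)).
split; first by rewrite subrKC.
  by rewrite le_min lo ler_wpM2r // ge_min lexx orbT.
rewrite subr_ge0 ge_min lexx /= minElt; case: ifP => _.
  by rewrite subrr mulr_ge0 // ltW.
by rewrite lerBlDl.
Qed.

(** * The running time *)

Section RunningTime.
Variables (R : realType) (a : R).
Hypothesis a_gt0 : 0 < a.
Implicit Types (I : instance R).

(** A single vertex would make [K] vanish, against [nnz K = Omega(n)]; this
    keeps [ln n] away from zero. *)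
Lemma admissible_gt1 I : admissible a I -> (1 < nvert I)%N.
Proof.
case=> n_gt0 [[_ diag _] _] _ _ nnz_ge.
rewrite ltn_neqAle n_gt0 andbT; apply: contraTneq nnz_ge => n1.
have -> : nnz (K_of I) = 0%N.
  apply/eqP; rewrite cards_eq0 -subset0; apply/subsetP => -[u v]; rewrite !inE.
  have eq_all (x y : 'I_(nvert I)) : x = y.
    by apply/val_inj => /=; have := ltn_ord x; have := ltn_ord y; lia.
  rewrite (eq_all u v) /= diag big_pred0 ?oppr0 ?eqxx // => w.
  by rewrite (eq_all w v) eqxx.
by rewrite -n1 mulr1 -ltNge.
Qed.

Lemma admissible_halts I : admissible a I ->
  exists (st : state I) (t : nat), terminates_in st t.
Proof.
move=> adm; have [n_gt0 [_ [pi_gt0 _]] tmax_gt0 _ _] := adm.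
have [inv _ no_halt _ _] := initialize_ok n_gt0 pi_gt0.
have [fuel halt] := iterate_halts tmax_gt0 inv no_halt.
exists (iterate fuel (initialize I).1).1.
exists ((initialize I).2 + (iterate fuel (initialize I).1).2)%N.
by split=> //; exists fuel; rewrite bindE.
Qed.

Lemma run_time I (st : state I) (t : nat) :
  admissible a I -> terminates_in st t ->
  counters_inv st /\
  (nnz (K_of I) + diag_work st <= t <=
     2 * nnz (K_of I) + 19 * nvert I + 2 * diag_work st +
     48 * (index_sum st * up_log 2 (nvert I).+1))%N.
Proof.
move=> adm [[fuel run] _]; have [n_gt0 [_ [pi_gt0 _]] tmax_gt0 _ _] := adm.
have [inv [sel0 log0] no_halt b0 c_init] := initialize_ok n_gt0 pi_gt0.
have cnt0 : counters_inv (initialize I).1.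
  split; first by rewrite sel0.
    by rewrite log0.
  by rewrite big1 // => v _; rewrite b0.
have [] := iterate_counters tmax_gt0 fuel inv cnt0 no_halt.
rewrite /diag_work /index_sum log0 !big_nil.
move: run; rewrite bindE => -[<- <-] cnt lo hi; split=> //; lia.
Qed.

Lemma nvert_le_nnz I : admissible a I ->
  (nvert I)%:R <= a^-1 * (nnz (K_of I))%:R :> R.
Proof. by case=> _ _ _ _ ?; rewrite ler_pdivlMl. Qed.

Let ln_factor : R := 2 / ln 2.

Lemma ln_factor_gt0 : 0 < ln_factor.
Proof. by rewrite divr_gt0 // ln_gt0 // ltr1n. Qed.

Lemma time_general :
  time_Theta_plus_O (fun I st => admissible a I)
    (fun I st => M_offdiag st + M_diag st + (nnz (K_of I))%:R)
    (fun I st => (\sum_(1 <= j < (k_of st).+2) j%:R * (iter_count st j)%:R)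
                   * ln (nvert I)%:R).
Proof.
have := ln_factor_gt0; have ai_gt0 : 0 < a^-1 by rewrite invr_gt0.
move=> lf_gt0.
(* Initialization costs 19 units per vertex, one for the key and 18 for the
   heap, and [n <= a^-1 * nnz K]. *)
apply: (@time_Theta_plus_O_of_bounds _ _ _ _ 1 (4 + 19 * a^-1)
  (48 * ln_factor)).
- exact: ltr01.
- lra.
- by rewrite mulr_gt0.
move=> I st t adm term; have [cnt /andP[lo hi]] := run_time adm term.
have n_gt1 := admissible_gt1 adm.
have [off_ge0 off_le] := andP (M_offdiag_bounds cnt).
have diagE := M_diagE cnt; rewrite (index_sum_natr cnt).
have n_le := nvert_le_nnz adm; have ln_n_ge0 : 0 <= ln (nvert I)%:R :> R.
  by rewrite ln_ge0 // ler1n ltnW.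
have d_le : (index_sum st)%:R * (up_log 2 (nvert I).+1)%:R <=
    (index_sum st)%:R * (ln_factor * ln (nvert I)%:R) :> R.
  by rewrite ler_wpM2l // up_log_le_ln.
have nnz_ge0 := ler0n R (nnz (K_of I)).
have dw_ge0 := ler0n R (diag_work st).
move: lo hi; rewrite -!(ler_nat R) !natrD !natrM => lo hi.
split; first by lra.
  by rewrite mulr_ge0.
apply/andP; split; first by lra.
have : 0 <= a^-1 * (M_offdiag st + M_diag st) by rewrite mulr_ge0 //; lra.
nra.
Qed.

(** Both special cases have this form: [X] is the order of the inner products
    and [1 + Y] that of the sum of the indices. The summand 1 is the first
    iteration, whose logarithmic cost is absorbed by [nnz K >= a n]. *)
Lemma time_special (P : forall I, state I -> Prop)
    (X Y : forall I, state I -> nat) :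
  (forall I (st : state I), P I st -> counters_inv st ->
     [/\ (X I st <= 12 * diag_work st)%N, (diag_work st <= 2 * X I st)%N
       & (index_sum st <= 1 + 2 * Y I st)%N]) ->
  time_Theta_plus_O (fun I st => admissible a I /\ P I st)
    (fun I st => (X I st)%:R + (nnz (K_of I))%:R)
    (fun I st => (Y I st)%:R * ln (nvert I)%:R).
Proof.
move=> bounds; have lf_gt0 := ln_factor_gt0.
have ai_gt0 : 0 < a^-1 by rewrite invr_gt0.
(* 67 = 19 + 48: besides the initialization, the vertices pay for the term
   [48 * up_log 2 n.+1 <= 48 * n] of the first iteration. *)
apply: (@time_Theta_plus_O_of_bounds _ _ _ _ 12^-1 (4 + 67 * a^-1)
  (96 * ln_factor)).
- by rewrite invr_gt0.
- lra.
- by rewrite mulr_gt0.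
move=> I st t [adm P_st] term; have [cnt /andP[lo hi]] := run_time adm term.
have [X_le le_X le_Y] := bounds I st P_st cnt.
have n_gt1 := admissible_gt1 adm; have n_le := nvert_le_nnz adm.
have ln_n_ge0 : 0 <= ln (nvert I)%:R :> R by rewrite ln_ge0 // ler1n ltnW.
have d_ln : (Y I st)%:R * (up_log 2 (nvert I).+1)%:R <=
    (Y I st)%:R * (ln_factor * ln (nvert I)%:R) :> R.
  by rewrite ler_wpM2l // up_log_le_ln.
have hi' : (t <= 2 * nnz (K_of I) + 67 * nvert I + 4 * X I st +
    96 * (Y I st * up_log 2 (nvert I).+1))%N.
  have := up_log_le (nvert I).
  have := leq_mul le_Y (leqnn (up_log 2 (nvert I).+1)).
  by rewrite mulnDl mul1n; lia.
have X_ge0 := ler0n R (X I st); have nnz_ge0 := ler0n R (nnz (K_of I)).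
move: lo hi' X_le; rewrite -!(ler_nat R) !natrD !natrM => lo hi' X_le.
split; first by rewrite addr_ge0.
  by rewrite mulr_ge0.
apply/andP; split; first by lra.
have : 0 <= a^-1 * (X I st)%:R by rewrite mulr_ge0 // ltW.
nra.
Qed.

End RunningTime.

Theorem theorem4p3 (R : realType) (a : R) (a_gt0 : 0 < a) :
  [/\ forall I : instance R, admissible a I ->
        exists (st : state I) (t : nat), terminates_in st t,
      time_Theta_plus_O (fun I st => admissible a I)
        (fun I st => M_offdiag st + M_diag st + (nnz (K_of I))%:R)
        (fun I st => (\sum_(1 <= j < (k_of st).+2) j%:R * (iter_count st j)%:R)
                       * ln (nvert I)%:R),
      time_Theta_plus_O (fun I st => admissible a I /\ lazy_best st)
        (fun I st => (k_of st)%:R ^+ 3 + (nnz (K_of I))%:R)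
        (fun I st => (k_of st)%:R ^+ 2 * ln (nvert I)%:R)
    & time_Theta_plus_O (fun I st => admissible a I /\ lazy_worst st)
        (fun I st => (k_of st)%:R ^+ 3 * (nvert I)%:R + (nnz (K_of I))%:R)
        (fun I st => (k_of st)%:R ^+ 2 * (nvert I)%:R * ln (nvert I)%:R)].
Proof.
split.
- exact: admissible_halts.
- exact: time_general.
- have [|c1 [c2 [c3 [? ? ? bounds]]]] := @time_special R a a_gt0 (@lazy_best R)
    (fun I st => k_of st ^ 3)%N (fun I st => k_of st ^ 2)%N.
    by move=> I st best cnt; apply: lazy_best_bounds.
  by exists c1, c2, c3; split=> // I st t; rewrite -!natrX; apply: bounds.
- have [|c1 [c2 [c3 [? ? ? bounds]]]] := @time_special R a a_gt0 (@lazy_worst R)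
    (fun I st => k_of st ^ 3 * nvert I)%N (fun I st => k_of st ^ 2 * nvert I)%N.
    by move=> I st worst cnt; apply: lazy_worst_bounds.
  exists c1, c2, c3; split=> // I st t; rewrite -!natrX -!natrM.
  exact: bounds.
Qed.
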